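(* There is a distributed algorithm in the LOCAL model for the weighted 2-spanner problem that always outputs a 2-spanner of cost at most $O(\log\Delta)$ times the minimum cost, and terminates within $O(\log n\log(\Delta W))$ rounds with high probability, where $n$ is the number of vertices, $\Delta$ the maximum degree, and $W$ the ratio between the maximum and the minimum positive edge weight.
   Context: Weighted 2-spanner problem: the input is a connected undirected graph $G=(V,E)$ with non-negative edge weights $w(e)$ (all edges have length 1). A subgraph $H\subseteq E$ is a 2-spanner if for every edge $\{u,v\}\in E$ there is a path with at most 2 edges between $u$ and $v$ in $H$; the goal is to minimize $w(H)=\sum_{e\in H}w(e)$. Distributed setting: the input graph is the communication network; vertices have unique IDs and initially know their incident edges and weights; synchronous rounds; each vertex outputs a subset of its incident edges and the union is the spanner. LOCAL model: messages of unbounded size. ''With high probability'' means with probability at least $1-1/n^c$ for a constant $c\geq1$. *)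

(* Defs.v *)
From HB Require Import structures.
From mathcomp Require Import all_boot all_order all_algebra.
From mathcomp Require Import all_classical all_reals all_analysis.
Set Implicit Arguments.
Unset Strict Implicit.
Unset Printing Implicit Defensive.
Import Order.TTheory GRing.Theory Num.Theory.
Local Open Scope classical_set_scope.
Local Open Scope ring_scope.

(* A graph on V is given by its edge set E; the edge {u, v} is [set u; v], and
   a subgraph is a subset of E. *)
Section Graphs.
Variables (R : realType) (V : finType).
Implicit Types (E H : {set {set V}}) (w : {set V} -> R) (u v : V).

Definition simple_graph E : Prop := forall e : {set V}, e \in E -> #|e| = 2%N.

Definition adj E : rel V := fun u v => ([set u; v]%SET \in E).

Definition connected_graph E : Prop := forall u v, connect (adj E) u v.

Definition degree E v : nat := #|[set u | adj E v u]%SET|.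

Definition max_degree E : nat := \max_(v : V) degree E v.

(* The seeds 0 and max_weight are neutral for nonnegative weights, as long as
   some edge has positive weight. *)
Definition max_weight E w : R := \big[Num.max/0]_(e in E) w e.

Definition min_pos_weight E w : R :=
  \big[Num.min/max_weight E w]_(e in E | 0 < w e) w e.

(* Equal to 0 if no edge has positive weight. *)
Definition weight_ratio E w : R := max_weight E w / min_pos_weight E w.

Definition is_spanner (k : nat) E H : Prop :=
  H \subset E /\
  forall u v, adj E u v ->
    exists p : seq V, [/\ path (adj H) u p, last u p = v & (size p <= k)%N].

Definition cost w H : R := \sum_(e in H) w e.

(* A minimum: E is a k-spanner of itself for k >= 1, and there are finitely
   many subgraphs. *)
Definition min_spanner_cost (k : nat) E w : R :=
  inf [set cost w H | H in [set H | is_spanner k E H]].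

End Graphs.

(* The logarithm inside O(.), truncated below at 1 so that the bounds do not
   degenerate to 0 on the instances with Delta, W or n equal to 1. *)
Definition log_ge1 (R : realType) (x : R) : R := Num.max 1 (ln x).

(* A randomized LOCAL algorithm, the same at every vertex. State and message
   types are arbitrary, so neither message size nor local computation is
   bounded.
   - init id view tape: initial state of the vertex with identifier id, where
     view lists, for each incident edge, the identifier of the other endpoint
     and the weight, and tape is the vertex's private string of random bits;
   - send s i: the message sent to the neighbour with identifier i;
   - recv s msgs: the next state, where msgs lists the received messages,
     each with the identifier of its sender;
   - output s: None while the vertex is running, and Some l once it has
     terminated with output the edges to its neighbours with identifier in l.
   In particular n, the maximum degree and the weight ratio are not given. *)
Record local_algorithm (R : realType) := LocalAlgorithm {
  state : Type;
  message : Type;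
  init : nat -> seq (nat * R) -> (nat -> bool) -> state;
  send : state -> nat -> message;
  recv : state -> seq (nat * message) -> state;
  output : state -> option (seq nat)
}.

Section Execution.
Variables (R : realType) (A : local_algorithm R) (V : finType).
Variables (E : {set {set V}}) (w : {set V} -> R) (ID : V -> nat).
Variable tape : V -> nat -> bool.

(* Sorted by identifier, so that the enumeration order of V, which is not
   part of the input, is not disclosed to the vertices. *)
Definition neighbours (v : V) : seq V :=
  sort (fun x y => (ID x <= ID y)%N) [seq u <- enum V | adj E v u].

Definition view (v : V) : seq (nat * R) :=
  [seq (ID u, w [set v; u]%SET) | u <- neighbours v].

(* States after t rounds. The state of a terminated vertex is frozen: its
   output is final and it can only keep repeating the same messages. *)
Fixpoint states_at (t : nat) : V -> state A :=
  if t is t'.+1 then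
    let s := states_at t' in
    fun v => if isSome (output (s v)) then s v
             else recv (s v) [seq (ID u, send (s u) (ID v)) | u <- neighbours v]
  else fun v => init A (ID v) (view v) (tape v).

Definition terminated (t : nat) : Prop :=
  forall v, isSome (output (states_at t v)).

(* The union of the outputs; identifiers that belong to no vertex are
   ignored. *)
Definition output_graph (t : nat) : {set {set V}} :=
  [set [set p.1; p.2] | p in
     [set p : V * V | ID p.2 \in odflt [::] (output (states_at t p.1))]]%SET.

End Execution.

Section Randomness.
Variables (R : realType) (d : measure_display) (T : measurableType d).
Variables (P : probability T R) (I : eqType).

Definition mutually_independent (X : I -> T -> bool) : Prop :=
  forall (J : seq I) (B : I -> set bool), uniq J ->
    P (\bigcap_(i in [set` J]) (X i @^-1` B i)) =
    (\prod_(i <- J) P (X i @^-1` B i))%E.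

Definition iid_fair_bits (X : I -> T -> bool) : Prop :=
  [/\ forall i, measurable_fun setT (X i),
      forall i, P (X i @^-1` [set true]) = (2^-1)%:E
    & mutually_independent X].

End Randomness.

(* Main.v *)
(* The algorithm is the distributed greedy set cover whose elements are the
   ordered adjacent pairs and whose sets are stars: a star at [v] covers the
   pairs inside it, at the cost of its edges. Every vertex holds its densest
   star, up to a factor 2, for the uncovered pairs; every pair votes for the
   star of least random rank among the densest ones that contain it, and a star
   that collects an eighth of its pairs enters the spanner. A pair is thus paid
   for at a price that is within a constant of the best density around it, so
   the total price telescopes, along each star of an optimal spanner, to a
   harmonic sum. For the running time, at the highest density level the total
   size of the stars drops in expectation by a constant factor per iteration,
   and summing the sizes over the O(log (Delta W)) levels with geometric weights
   gives one potential, at most n^O(log (Delta W)), which decreases by a constant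
   factor in expectation until everything is covered. Iteration [k] uses [k]-bit
   ranks, which makes ties rare once [k] exceeds O(log n), without knowing n;
   ties are broken by identifiers, so that every iteration makes progress and
   termination holds for every tape. *)
Require Import Defs.
From HB Require Import structures.
From mathcomp Require Import all_boot all_order all_fingroup all_algebra.
From mathcomp Require Import reals zify ring lra.
From mathcomp Require classical_sets.
Set Implicit Arguments.
Unset Strict Implicit.
Unset Printing Implicit Defensive.
Import Order.TTheory GRing.Theory Num.Theory.

(** * Voting with random ranks *)

(** The obstacle is that a star chosen by maximizing the density itself is neither unique nor
    monotone: once some pairs are covered, a vertex could switch to an unrelated star, and the size
    of a level could grow. Density at least [c] is therefore tested by maximizing [gain], the number
    of pairs minus [c] times the weight, which is supermodular; its largest maximizer is canonical,
    so it can be recomputed locally, and it can only shrink with the uncovered set. Hence no level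
    ever grows, not even in the iterations with too few random bits, and a potential argument is
    possible. Edges of weight 0 would make densities infinite, so they are all taken at the start
    for free. Probabilities are counts over finite sets of rank assignments; the measure enters only
    when tapes are translated into such assignments. *)

Section Voting.
Variables (V P W : finType) (key : W -> nat) (C : V -> {set P}).
Implicit Types (A B : {set V}) (rk : {ffun V -> W}) (p : P).

Local Notation total := #|{ffun V -> W}|.

Hypothesis rare_ties : forall u v : V, u != v ->
  (8 * #|V| ^ 2 * #|[set rk : {ffun V -> W} | key (rk u) == key (rk v)]| <= total)%N.

(** A tie at the minimum has no winner here. Unlike breaking ties by identifiers, this is symmetric
    under permutations of the vertices. *)
Definition strict_min A rk v : bool := [forall (u | u \in A :\ v), key (rk v) < key (rk u)]%N.

Definition wins A v : nat := \sum_rk strict_min A rk v.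

Definition voters p : {set V} := [set v | p \in C v].

Definition elected rk v : bool :=
  (#|C v| <= 8 * #|[set p in C v | strict_min (voters p) rk v]|)%N.

Lemma strict_minU A B rk v :
  strict_min (A :|: B) rk v = strict_min A rk v && strict_min B rk v.
Proof.
apply/forall_inP/andP => [h|[/forall_inP h1 /forall_inP h2] u].
  by split; apply/forall_inP => u; rewrite !inE => /andP[uv uA];
    apply: h; rewrite !inE uv uA ?orbT.
by rewrite !inE => /andP[uv /orP[uA|uB]]; [apply: h1|apply: h2]; rewrite !inE uv.
Qed.

Lemma strict_min_inj A rk u v : u \in A -> v \in A ->
  strict_min A rk u -> strict_min A rk v -> u = v.
Proof.
move=> uA vA /forall_inP hu /forall_inP hv; apply/eqP/negPn/negP => uv.
have := hu v; rewrite !inE eq_sym uv vA => /(_ isT).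
have := hv u; rewrite !inE uv uA => /(_ isT); lia.
Qed.

(** Swapping the ranks of [u] and [v] is a bijection of the rank assignments that exchanges the two
    events. *)
Lemma wins_sym A u v : u \in A -> v \in A -> wins A u = wins A v.
Proof.
move=> uA vA; pose h rk : {ffun V -> W} := [ffun x => rk (tperm u v x)].
have hK : involutive h by move=> rk; apply/ffunP => x; rewrite !ffunE tpermK.
rewrite /wins (reindex_inj (inv_inj hK)); apply: eq_bigr => rk _.
congr (nat_of_bool _).
have tA x : x \in A -> tperm u v x \in A by case: tpermP => [_|_|].
apply/forall_inP/forall_inP => mn x; rewrite !inE => /andP[xn xA].
  have := mn (tperm u v x); rewrite !inE !ffunE tpermL tpermK; apply.
  by rewrite tA // andbT -(inj_eq (@perm_inj _ (tperm u v))) tpermK tpermL.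
rewrite !ffunE tpermL; apply: mn; rewrite !inE tA // andbT.
by rewrite -(inj_eq (@perm_inj _ (tperm u v))) tpermK tpermR.
Qed.

Lemma sum_strict_min A rk : (\sum_(u in A) strict_min A rk u <= 1)%N.
Proof.
case: (pickP (fun u => (u \in A) && strict_min A rk u)) => [u /andP[uA mu]|n].
  rewrite (bigD1 u) //= big1 ?addn0 ?leq_b1 // => v /andP[vA vu].
  case mv: (strict_min _ _ _) => //.
  by case/eqP: vu; apply: (strict_min_inj vA uA mv mu).
by rewrite big1 // => u uA; have := n u; rewrite uA /= => ->.
Qed.

Lemma card_wins A v : v \in A -> (\sum_rk \sum_(u in A) strict_min A rk u = #|A| * wins A v)%N.
Proof.
move=> vA; rewrite exchange_big /= -sum_nat_const.
by apply: eq_bigr => u uA; rewrite -(wins_sym uA vA).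
Qed.

Lemma wins_ub A v : v \in A -> (#|A| * wins A v <= total)%N.
Proof.
move=> vA; rewrite -card_wins // -sum1_card; apply: leq_sum => rk _.
exact: sum_strict_min.
Qed.

Lemma strict_min_or_tie A rk v : v \in A ->
  (1 <= \sum_(u in A) strict_min A rk u +
        \sum_(q : V * V | q.1 != q.2) (key (rk q.1) == key (rk q.2)))%N.
Proof.
move=> vA; case: (arg_minnP (fun u => key (rk u)) vA) => u uA mn.
have [mu|] := boolP (strict_min A rk u).
  by rewrite (bigD1 u) //= mu.
case/forall_inPn => x; rewrite !inE => /andP[xu xA]; rewrite -leqNgt => le.
rewrite addnC (bigD1 (x, u)) //= eqn_leq le mn //.
Qed.

(** If no two vertices tie, some element of [A] wins; the union bound over ordered pairs, each tied
    in at most a fraction [1 / (8 * #|V| ^ 2)] of the assignments, loses an eighth of them. *)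
Lemma wins_lb A v : v \in A -> (7 * total <= 8 * (#|A| * wins A v))%N.
Proof.
move=> vA; have v0 : (0 < #|V|)%N by apply/card_gt0P; exists v.
pose t := (\sum_(q : V * V | q.1 != q.2)
  #|[set rk : {ffun V -> W} | key (rk q.1) == key (rk q.2)]|)%N.
have ht : (8 * t <= total)%N.
  rewrite -(leq_pmul2l (m := #|V| ^ 2)) ?expn_gt0 ?v0 // mulnA.
  have -> : (#|V| ^ 2 = #|{: V * V}|)%N by rewrite card_prod mulnn.
  rewrite -[leqRHS]sum_nat_const /t big_distrr /= [leqLHS]big_mkcond [leqRHS]big_mkcond.
  apply: leq_sum => q _; case: ifP => // q12.
  by have := rare_ties q12; rewrite card_prod -mulnn [(8 * _)%N]mulnC.
suff : (total <= #|A| * wins A v + t)%N by lia.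
rewrite -card_wins // -sum1_card.
have -> : t = (\sum_(rk : {ffun V -> W}) \sum_(q : V * V | q.1 != q.2)
    (key (rk q.1) == key (rk q.2)))%N.
  rewrite exchange_big; apply: eq_bigr => q _.
  rewrite -sum1_card big_mkcond; apply: eq_bigr => rk _.
  by rewrite inE; case: eqP.
by rewrite -big_split; apply: leq_sum => rk _; apply: strict_min_or_tie vA.
Qed.

Local Notation deg p := #|voters p|.
Local Notation below v p := [set p' in C v | (deg p' <= deg p)%N].
Local Notation heavy v p := (#|C v| <= 2 * #|below v p|)%N.

(** Among the elements that are not heavy, take one with the most voters: all of them lie below it,
    and less than half of [C v] does. *)
Lemma card_heavy v : (#|C v| <= 2 * #|[set p in C v | heavy v p]|)%N.
Proof.
pose Q := [set p in C v | ~~ heavy v p].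
have cQ : (#|C v| = #|[set p in C v | heavy v p]| + #|Q|)%N.
  rewrite -[LHS](cardsID [set p | heavy v p] (C v)); congr (_ + _)%N.
    by apply: eq_card => p; rewrite !inE.
  by apply: eq_card => p; rewrite !inE andbC.
case: (set_0Vmem Q) => [Q0|[p0 p0Q]]; first by rewrite Q0 cards0 in cQ; lia.
case: (arg_maxnP (fun p => deg p) p0Q) => p pQ mx.
have {}mx p' : p' \in Q -> (deg p' <= deg p)%N by apply: mx.
have : (#|Q| <= #|below v p|)%N.
  apply: subset_leq_card; apply/subsetP => p' p'Q; rewrite inE mx // andbT.
  by move: p'Q; rewrite inE => /andP[].
have {}pQ : p \in Q := pQ; move: pQ; rewrite inE => /andP[_]; lia.
Qed.

(** Without election [v] wins fewer than [#|C v| / 8] elements, which is at most a quarter of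
    [below v p] when [p] is heavy. *)
Lemma not_elected_bound rk v p : heavy v p -> ~~ elected rk v ->
  (3 * #|below v p| <= 4 * \sum_(p' in below v p) ~~ strict_min (voters p') rk v)%N.
Proof.
move=> hp; rewrite /elected -ltnNge => ne.
have : (#|below v p| <= #|[set p' in C v | strict_min (voters p') rk v]| +
          \sum_(p' in below v p) ~~ strict_min (voters p') rk v)%N.
  rewrite -[leqLHS]sum1_card; apply: (@leq_trans (\sum_(p' in below v p)
      (strict_min (voters p') rk v + ~~ strict_min (voters p') rk v))).
    by apply: leq_sum => p' _; case: strict_min.
  rewrite big_split leq_add2r -[leqRHS]sum1_card [leqLHS]big_mkcond [leqRHS]big_mkcond /=.
  apply: leq_sum => p' _; rewrite !inE; case: (p' \in C v) => //=.
  by case: ifP => // _; case: strict_min.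
lia.
Qed.

(** Winning [p] but not [p'] is winning [p] but not the union of the two voter sets, which is at
    most twice as large: the probability is at most [1 - 7 / 16 = 9 / 16] over [deg p]. *)
Lemma wins_diff v p p' : v \in voters p -> p' \in below v p ->
  (16 * (deg p * \sum_(rk : {ffun V -> W})
       (strict_min (voters p) rk v && ~~ strict_min (voters p') rk v))
     <= 9 * total)%N.
Proof.
rewrite !inE => vp /andP[vp' le].
have e : (wins (voters p) v = wins (voters p :|: voters p') v +
   \sum_(rk : {ffun V -> W}) (strict_min (voters p) rk v && ~~ strict_min (voters p') rk v))%N.
  rewrite /wins -big_split; apply: eq_bigr => rk _; rewrite strict_minU.
  by case: (strict_min (voters p) rk v); case: (strict_min (voters p') rk v).
have ub := @wins_ub (voters p) v; rewrite inE vp e in ub.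
have := @wins_lb (voters p :|: voters p') v; rewrite !inE vp => /(_ isT).
have := ub isT.
have : (#|voters p :|: voters p'| <= 2 * deg p)%N.
  by rewrite (leq_trans (leq_card_setU _ _)) //; lia.
set m := #|_ :|: _|; set x := wins _ _; set y := (\sum_rk _)%N; set d := deg p.
move=> md h1 h2; have : (m * x <= 2 * d * x)%N by rewrite leq_mul2r md orbT.
move: h1 h2; rewrite mulnDr; lia.
Qed.

(** Averaging over [below v p], winning [p] without being elected has probability at most
    [4 / 3 * 9 / 16 = 3 / 4] over [deg p], while winning [p] has at least [7 / 8]; an eighth
    remains. *)
Lemma elected_lb v p : p \in C v -> heavy v p ->
  (total <= 8 * (deg p * \sum_(rk : {ffun V -> W}) (strict_min (voters p) rk v && elected rk v)))%N.
Proof.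
move=> pv hp; have vp : v \in voters p by rewrite inE.
pose F := (\sum_(rk : {ffun V -> W}) (strict_min (voters p) rk v && ~~ elected rk v))%N.
set G := (\sum_rk _)%N.
have eN : (wins (voters p) v = G + F)%N.
  rewrite /wins /G /F -big_split; apply: eq_bigr => rk _.
  by case: strict_min; case: elected.
have L0 : (0 < #|below v p|)%N by apply/card_gt0P; exists p; rewrite !inE pv leqnn.
have lb := wins_lb vp; rewrite eN in lb.
have hF : (3 * #|below v p| * F <= 4 * \sum_(p' in below v p) \sum_(rk : {ffun V -> W})
    (strict_min (voters p) rk v && ~~ strict_min (voters p') rk v))%N.
  rewrite exchange_big /= /F !big_distrr /=; apply: leq_sum => rk _.
  case: strict_min => //=; last by rewrite muln0.
  have [//|ne] := boolP (elected rk v); first by rewrite muln0.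
  by rewrite muln1; apply: not_elected_bound.
have hS : (16 * deg p * (\sum_(p' in below v p) \sum_(rk : {ffun V -> W})
    (strict_min (voters p) rk v && ~~ strict_min (voters p') rk v)) <=
    #|below v p| * (9 * total))%N.
  rewrite big_distrr /= -sum_nat_const; apply: leq_sum => p' hp'.
  by rewrite -mulnA; apply: wins_diff.
move: hF hS; set S := (\sum_(p' in _) _)%N; set L := #|below v p| in L0 *.
set d := deg p in lb *; move=> hF hS.
have : (48 * (d * F) * L <= 36 * total * L)%N.
  apply: (@leq_trans (16 * d * (4 * S))); last by lia.
  rewrite (_ : 48 * (d * F) * L = 16 * d * (3 * L * F))%N; last by lia.
  by rewrite leq_mul2l hF orbT.
rewrite leq_pmul2r // => h; move: lb; rewrite mulnDr; lia.
Qed.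

(* Half of the elements of [C v] have at least as many voters as half of
   [C v]; such an element voting for [v] makes [v] likely to be elected, and
   then it leaves [C u] for all its voters [u]. *)
Lemma expected_covered (covered : {ffun V -> W} -> pred P) :
  (forall rk v p, p \in C v -> elected rk v -> covered rk p) ->
  (total * \sum_v #|C v| <= 16 * \sum_rk \sum_v #|[set p in C v | covered rk p]|)%N.
Proof.
move=> hcov.
(* A covered pair leaves [deg p] sets, and at most one voter is its strict minimum, so on the right
   of the comparison it also counts at most [deg p] times. *)
have h rk : (\sum_v #|[set p in C v | covered rk p]| >=
   \sum_v \sum_(p in C v) deg p * (strict_min (voters p) rk v && elected rk v))%N.
  have -> : (\sum_v #|[set p in C v | covered rk p]| = \sum_p deg p * covered rk p)%N.
    under eq_bigr do rewrite -sum1_card.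
    rewrite (exchange_big_dep xpredT) //=; apply: eq_bigr => p _.
    rewrite -sum_nat_const big_mkcond [RHS]big_mkcond.
    apply: eq_bigr => v _; rewrite !inE.
    by case: (p \in C v); case: (covered rk p).
  rewrite (exchange_big_dep xpredT) //=; apply: leq_sum => p _.
  rewrite -big_distrr leq_mul2l; apply/orP; right.
  case: (boolP (covered rk p)) => [_|nc].
    apply: leq_trans (sum_strict_min (voters p) rk).
    rewrite (eq_bigl (fun v => v \in voters p)) => [|v]; last by rewrite inE.
    by apply: leq_sum => v _; case: strict_min; case: elected.
  rewrite big1 // => v pv; case: (boolP (elected rk v)); rewrite ?andbF // => el.
  by rewrite (hcov _ _ _ pv el) in nc.
apply: (@leq_trans (16 * \sum_(rk : {ffun V -> W}) \sum_v \sum_(p in C v) deg p *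
    (strict_min (voters p) rk v && elected rk v))); last first.
  by rewrite leq_mul2l; apply: leq_sum => rk _; apply: h.
rewrite exchange_big /= !big_distrr /=; apply: leq_sum => v _.
rewrite exchange_big /=.
apply: (@leq_trans (total * (2 * #|[set p in C v | heavy v p]|))).
  by rewrite leq_mul2l card_heavy orbT.
rewrite mulnCA (_ : 16 = 2 * 8)%N // -mulnA leq_mul2l /= mulnC -sum_nat_const.
rewrite big_distrr /= [leqLHS]big_mkcond [leqRHS]big_mkcond.
apply: leq_sum => p _; rewrite inE; case: ifP => // /andP[pv hp].
by rewrite pv -big_distrr; apply: elected_lb.
Qed.

End Voting.

Local Open Scope ring_scope.

(** * Stars and density thresholds *)

Section Stars.
Variables (R : realType) (V : finType) (cl : V -> {set V}) (wc : V -> V -> R).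
Implicit Types (U : {set V * V}) (B : {set V}) (v : V) (c : R).

Definition cov U B : {set V * V} := [set p in U | (p.1 \in B) && (p.2 \in B)].

Definition star_weight v B : R := \sum_(u in B) wc v u.

Definition gain c U v B : R := #|cov U B|%:R - c * star_weight v B.

Definition max_gain c U v B : bool :=
  (B \subset cl v) &&
  [forall B' : {set V}, (B' \subset cl v) ==> (gain c U v B' <= gain c U v B)].

Definition star c U v : {set V} := \bigcup_(B | max_gain c U v B) B.

Lemma cov_sub U B : cov U B \subset U.
Proof. by apply/subsetP => p; rewrite inE => /andP[]. Qed.

Lemma covS U U' B B' : U' \subset U -> B' \subset B -> cov U' B' \subset cov U B.
Proof.
move=> /subsetP sU /subsetP sB; apply/subsetP => p; rewrite !inE.
by case/and3P => /sU -> /sB -> /sB ->.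
Qed.

Lemma cov0 U : cov U set0 = set0.
Proof. by apply/setP => p; rewrite !inE !andbF. Qed.

Lemma covI U B B' : cov U (B :&: B') = cov U B :&: cov U B'.
Proof.
apply/setP => p; rewrite !inE.
by case: (p \in U); case: (p.1 \in B); case: (p.2 \in B); rewrite //= ?andbF.
Qed.

Lemma star_weight0 v : star_weight v set0 = 0.
Proof. by rewrite /star_weight big_set0. Qed.

Lemma star_weightUI v B B' :
  star_weight v (B :|: B') + star_weight v (B :&: B') =
  star_weight v B + star_weight v B'.
Proof.
rewrite /star_weight 4!(big_mkcond (fun u => u \in _)) -!big_split /=.
apply: eq_bigr => u _; rewrite !inE.
by case: (u \in B); case: (u \in B'); rewrite ?addr0 ?add0r.
Qed.

Lemma card_covUI U B B' :
  (#|cov U B| + #|cov U B'| <= #|cov U (B :|: B')| + #|cov U (B :&: B')|)%N.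
Proof.
rewrite covI -cardsUI leq_add2r subset_leq_card // subUset.
by rewrite !covS ?subsetUl ?subsetUr.
Qed.

(** Supermodularity: the weight is modular, and the pairs inside [B] or inside [B'] are all inside
    the union, those inside both being inside the intersection. *)
Lemma gainUI c U v B B' :
  gain c U v B + gain c U v B' <= gain c U v (B :|: B') + gain c U v (B :&: B').
Proof.
have := card_covUI U B B'; rewrite -(ler_nat R) !natrD => h.
have := star_weightUI v B B'; rewrite /gain => e.
have -> : star_weight v (B :|: B') = star_weight v B + star_weight v B' -
  star_weight v (B :&: B') by rewrite -e addrK.
lra.
Qed.

Lemma gain0 c U v : gain c U v set0 = 0.
Proof. by rewrite /gain cov0 cards0 star_weight0 mulr0 subr0. Qed.

Lemma ex_max_gain c U v : exists B, max_gain c U v B.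
Proof.
case: (@arg_maxP _ _ _ set0 (fun B => B \subset cl v) (gain c U v)).
  exact: sub0set.
move=> B sB mB; exists B; rewrite /max_gain sB /=.
by apply/forallP => B'; apply/implyP => /mB.
Qed.

(** The intersection gains no more than [B], so supermodularity forces the union to gain at least as
    much as [B']. *)
Lemma max_gainU c U v B B' :
  max_gain c U v B -> max_gain c U v B' -> max_gain c U v (B :|: B').
Proof.
case/andP=> sB /forallP mB; case/andP=> sB' /forallP mB'.
rewrite /max_gain subUset sB sB' /=; apply/forallP => D; apply/implyP => sD.
have sI : B :&: B' \subset cl v by rewrite subIset // sB.
have := gainUI c U v B B'.
have := implyP (mB _) sI; have := implyP (mB' _) sD; lra.
Qed.

Lemma star_max c U v : max_gain c U v (star c U v).
Proof.
rewrite /star; have [B0 mB0] := ex_max_gain c U v.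
rewrite -big_filter; have : B0 \in [seq B <- index_enum _ | max_gain c U v B].
  by rewrite mem_filter mB0 mem_index_enum.
have : all (max_gain c U v) [seq B <- index_enum _ | max_gain c U v B].
  by apply/allP => B; rewrite mem_filter => /andP[].
case: [seq _ <- _ | _] => [|B s] //= /andP[mB ms] _.
elim: s B mB ms => [|B' s IH] B mB /=; first by rewrite big_seq1.
case/andP=> mB' ms; rewrite !big_cons setUA.
have := IH (B :|: B') (max_gainU mB mB') ms.
by rewrite big_cons.
Qed.

Lemma star_cl c U v : star c U v \subset cl v.
Proof. by case/andP: (star_max c U v). Qed.

Lemma gain_star c U v B : B \subset cl v -> gain c U v B <= gain c U v (star c U v).
Proof. by move=> sB; case/andP: (star_max c U v) => _ /forallP/(_ B)/implyP; apply. Qed.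

Lemma sub_star c U v B : max_gain c U v B -> B \subset star c U v.
Proof. by move=> mB; apply: bigcup_sup. Qed.

(* Supermodularity of the gain makes the largest maximizer monotone in the set
   of uncovered pairs. *)
Lemma starS c U U' v : U' \subset U -> star c U' v \subset star c U v.
Proof.
move=> sU; set B := star c U v; set B' := star c U' v.
suff /sub_star : max_gain c U v (B :|: B') by apply: subset_trans; apply: subsetUr.
rewrite /max_gain subUset !star_cl /=.
apply/forallP => D; apply/implyP => sD.
apply: le_trans (gain_star _ _ sD) _; rewrite -/B.
have h1 := gainUI c U v B B'.
have h2 : gain c U' v (B :&: B') <= gain c U' v B'.
  by apply: gain_star; rewrite subIset // star_cl.
(* The weights cancel in these differences; what remains is that the number of pairs inside [B'] but
   not inside [B] grows with the uncovered set. *)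
suff : gain c U' v B' - gain c U' v (B :&: B') <= gain c U v B' - gain c U v (B :&: B').
  lra.
rewrite /gain.
have : #|cov U' B'|%:R - #|cov U' (B :&: B')|%:R <=
       #|cov U B'|%:R - #|cov U (B :&: B')|%:R :> R.
  rewrite -!natrB ?subset_leq_card ?covS ?subsetIr // ler_nat.
  rewrite -!cardsDS ?covS ?subsetIr // subset_leq_card //.
  apply/subsetP => p; rewrite !inE.
  case/andP => h /and3P[pU' p1 p2]; move: h.
  by rewrite pU' (subsetP sU _ pU') p1 p2 !andbT => ->.
lra.
Qed.

Definition attains c U v : bool := cov U (star c U v) != set0.

Hypothesis wc_ge0 : forall v u, u \in cl v -> 0 <= wc v u.

Lemma star_weight_ge0 v B : B \subset cl v -> 0 <= star_weight v B.
Proof. by move=> /subsetP sB; apply: sumr_ge0 => u /sB /wc_ge0. Qed.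

Lemma star_density c U v : c * star_weight v (star c U v) <= #|cov U (star c U v)|%:R.
Proof.
by have := gain_star c U (sub0set (cl v)); rewrite gain0 /gain subr_ge0.
Qed.

(** If the largest maximizer covers nothing, the maximal gain is at most 0, so a star of density at
    least [c] is itself a maximizer, hence contained in the largest one and covering nothing
    either. *)
Lemma attainsP c U v : 0 <= c ->
  reflect (exists B, [/\ B \subset cl v, cov U B != set0
                       & c * star_weight v B <= #|cov U B|%:R])
          (attains c U v).
Proof.
move=> c0; apply: (iffP idP) => [d|[B [sB dB hB]]].
  by exists (star c U v); split; [exact: star_cl | | exact: star_density].
apply: contraNneq dB => e; rewrite -subset0 -e covS //.
apply: sub_star; rewrite /max_gain sB; apply/forallP => D; apply/implyP => sD.
apply: le_trans (gain_star _ _ sD) _; apply: (@le_trans _ _ 0).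
  by rewrite /gain e cards0 sub0r oppr_le0 mulr_ge0 ?star_weight_ge0 ?star_cl.
by rewrite /gain subr_ge0.
Qed.

Lemma attainsS c c' U U' v : 0 <= c <= c' -> U' \subset U -> attains c' U' v -> attains c U v.
Proof.
case/andP => c0 cc' sU /(attainsP _ _ (le_trans c0 cc')) [B [sB /set0Pn[p pB] hB]].
apply/attainsP => //; exists B; split=> //.
  by apply/set0Pn; exists p; apply: (subsetP (covS sU (subxx _))).
apply: (@le_trans _ _ (c' * star_weight v B)); first by rewrite ler_wpM2r ?star_weight_ge0.
by apply: (le_trans hB); rewrite ler_nat subset_leq_card // covS.
Qed.

End Stars.

(** * Densities rounded down to powers of 2 *)

Section Thresholds.
Variables (R : realType) (V : finType) (cl : V -> {set V}) (wc : V -> V -> R).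
Hypothesis wc_ge0 : forall v u, u \in cl v -> 0 <= wc v u.
Implicit Types (U : {set V * V}) (B : {set V}) (v : V) (c : R).

Local Notation attains := (attains cl wc).

Definition weighty U : Prop :=
  forall v B, B \subset cl v -> cov U B != set0 -> 0 < star_weight wc v B.

Lemma weightyS U U' : U' \subset U -> weighty U -> weighty U'.
Proof.
move=> sU h v B sB /set0Pn[p pB]; apply: h => //.
by apply/set0Pn; exists p; apply: (subsetP (covS sU (subxx _))).
Qed.

(** The default 0 signals that no uncovered pair lies around [v]. Since [xget] depends on the
    predicate alone, a node that can evaluate the predicate obtains the same value. *)
Definition threshold U v : R := classical_sets.xget 0 (fun c =>
  (exists i : int, c = 2 ^ i) /\ attains c U v /\ ~~ attains (2 * c) U v).

Lemma threshold0 U v : cov U (cl v) = set0 -> threshold U v = 0.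
Proof.
move=> e; apply: classical_sets.xgetPN => c [[i ->]] [].
case/(attainsP wc_ge0 _ _ (exprz_ge0 _ (ler0n _ _))) => B [sB /set0Pn[p pB] _].
by have := subsetP (covS (subxx U) sB) _ pB; rewrite e inE.
Qed.

Lemma attains_bound U v : weighty U ->
  exists M : R, forall c, 0 <= c -> attains c U v -> c <= M.
Proof.
move=> pos; pose S := [set B : {set V} | (B \subset cl v) && (cov U B != set0)].
exists (#|U|%:R * \sum_(B in S) (star_weight wc v B)^-1) => c c0.
case/(attainsP wc_ge0 _ _ c0) => B [sB dB hB].
have wB := pos _ _ sB dB.
have : c <= #|U|%:R * (star_weight wc v B)^-1.
  rewrite ler_pdivlMr //; apply: (le_trans hB).
  by rewrite ler_nat subset_leq_card // cov_sub.
move/le_trans; apply; rewrite ler_wpM2l ?ler0n // (bigD1 B) ?inE ?sB //=.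
rewrite lerDl; apply: sumr_ge0 => D /andP[]; rewrite inE => /andP[sD dD] _.
by rewrite invr_ge0 ltW // pos.
Qed.

Lemma leq_exp2 m : (m%:R <= 2 ^+ m :> R).
Proof. by rewrite -natrX ler_nat ltnW // ltn_expl. Qed.

Lemma thresholdP U v : weighty U -> cov U (cl v) != set0 ->
  [/\ exists i : int, threshold U v = 2 ^ i, attains (threshold U v) U v
    & ~~ attains (2 * threshold U v) U v].
Proof.
move=> pos d0; rewrite /threshold.
have : exists c, (exists i : int, c = 2 ^ i) /\ attains c U v /\ ~~ attains (2 * c) U v.
  have W0 := pos _ _ (subxx _) d0.
  have [M hM] := attains_bound v pos.
  (* The whole neighbourhood attains [2 ^ - m0], and nothing attains [2 ^ m1]; the exponent just
     before the first failure is the witness. *)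
  pose m0 := Num.bound (star_weight wc v (cl v)); pose m1 := Num.bound M.
  pose f m := attains (2 ^ (m%:Z - m0%:Z)) U v.
  have p0 (i : int) : 0 <= (2 : R) ^ i by apply: exprz_ge0; apply: ler0n.
  have f0 : f 0%N.
    apply/(attainsP wc_ge0) => //; exists (cl v); split=> //.
    apply: (@le_trans _ _ 1); last by rewrite ler1n lt0n cards_eq0.
    rewrite sub0r -exprnN mulrC ler_pdivrMr ?mul1r ?exprn_gt0 //.
    apply: le_trans (leq_exp2 m0); apply: ltW.
    by have := archi_boundP (ltW W0).
  have f1 : exists m, ~~ f m.
    exists (m0 + m1)%N; apply/negP => /(hM _ (p0 _)).
    rewrite PoszD addrAC subrr add0r; apply/negP; rewrite -ltNge.
    apply: lt_le_trans (leq_exp2 m1); case: (leP 0 M) => M0.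
      by have := archi_boundP M0.
    by apply: lt_le_trans M0 _.
  case: (ex_minnP f1) => -[|m]; first by rewrite f0.
  move=> nf hm; have fm : f m by apply: contraT => /hm; rewrite ltnn.
  have e2 : 2 ^ (m.+1%:Z - m0%:Z) = 2 * 2 ^ (m%:Z - m0%:Z) :> R.
    by rewrite -[m.+1]addn1 PoszD addrAC expfzDr ?pnatr_eq0 // expr1z mulrC.
  exists (2 ^ (m%:Z - m0%:Z)); split; first by exists (m%:Z - m0%:Z).
  by split; [exact: fm | rewrite -e2].
by move=> ex; have [h1 [h2 h3]] := classical_sets.xgetPex 0 ex.
Qed.

Lemma threshold_gt0 U v : weighty U ->
  (0 < threshold U v) = (cov U (cl v) != set0).
Proof.
move=> pos; case: (altP (cov U (cl v) =P set0)) => [/threshold0 ->|d0].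
  by rewrite ltxx.
by have [[i ->] _ _] := thresholdP pos d0; rewrite exprz_gt0.
Qed.

Lemma threshold_ge0 U v : weighty U -> 0 <= threshold U v.
Proof.
move=> pos; case: (altP (cov U (cl v) =P set0)) => [/threshold0 ->|] //.
by rewrite -threshold_gt0 // => /ltW.
Qed.

Lemma pow2_lt (i j : int) : ((2 : R) ^ i < 2 ^ j) = (i < j).
Proof. by rewrite ltr_eXz2l ?ltr1n. Qed.

Lemma attains_threshold (i : int) U v : weighty U ->
  attains (2 ^ i) U v -> 2 ^ i <= threshold U v.
Proof.
move=> pos d; have i0 : 0 <= (2 : R) ^ i by rewrite exprz_ge0.
have d0 : cov U (cl v) != set0.
  apply: contraTneq d => e; apply/negP => /(attainsP wc_ge0 _ _ i0) [B [sB /set0Pn[p pB] _]].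
  by have := subsetP (covS (subxx U) sB) _ pB; rewrite e inE.
have [[j ->] _ nd] := thresholdP pos d0.
rewrite leNgt pow2_lt; apply/negP => ji; case/negP: nd.
apply: (attainsS wc_ge0 _ (subxx U) d).
rewrite mulr_ge0 ?exprz_ge0 //= mulrC -{2}(expr1z (2:R)) -expfzDr ?pnatr_eq0 //.
by rewrite ler_eXz2l ?ltr1n // lezD1.
Qed.

Lemma not_attains_threshold c U v : weighty U -> threshold U v < c -> 
  (exists i : int, c = 2 ^ i) -> ~~ attains c U v.
Proof.
by move=> pos h [i e]; apply/negP; rewrite e => /(attains_threshold pos); rewrite leNgt -e h.
Qed.

(** This is the factor 2 lost by rounding; it bounds every covering star at [v], not only the one
    that is kept. *)
Lemma card_cov_lt_threshold U v B : weighty U -> B \subset cl v ->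
  cov U B != set0 -> #|cov U B|%:R < 2 * threshold U v * star_weight wc v B.
Proof.
move=> pos sB dB; have d0 : cov U (cl v) != set0.
  case/set0Pn: dB => p pB; apply/set0Pn; exists p.
  exact: (subsetP (covS (subxx U) sB)).
have [_ _] := thresholdP pos d0; rewrite ltNge; apply: contra => h.
apply/(attainsP wc_ge0); first by rewrite mulr_ge0 ?threshold_ge0.
by exists B.
Qed.

End Thresholds.

(** * One iteration *)

Section Harmonic.
Variable R : realType.

Definition harmonic_sum (n : nat) : R := \sum_(i < n) i.+1%:R^-1.

Lemma harmonic_sum_ge0 n : 0 <= harmonic_sum n.
Proof. by apply: sumr_ge0 => i _; rewrite invr_ge0 ler0n. Qed.

(** The terms of index between [m] and [n] are all at least [1 / n]. This is the telescoping of
    greedy set cover. *)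
Lemma harmonic_sumB m n : (m <= n)%N ->
  (n - m)%:R / n%:R <= harmonic_sum n - harmonic_sum m.
Proof.
move=> mn; rewrite /harmonic_sum -!(big_mkord xpredT (fun i => i.+1%:R^-1)).
rewrite (big_cat_nat (leq0n m) mn) //= addrAC subrr add0r.
rewrite mulr_natl -sumr_const_nat; apply: ler_sum_nat => i /andP[_ lin].
by rewrite lef_pV2 ?posrE ?ltr0n ?ler_nat // (leq_ltn_trans _ lin).
Qed.

Lemma harmonic_sum_le m n : (m <= n)%N -> harmonic_sum m <= harmonic_sum n.
Proof.
move=> mn; rewrite -subr_ge0; apply: le_trans (harmonic_sumB mn).
by rewrite divr_ge0.
Qed.

End Harmonic.

Section Step.
Variables (R : realType) (V : finType) (cl : V -> {set V}) (wc : V -> V -> R).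
Hypothesis wc_ge0 : forall v u, u \in cl v -> 0 <= wc v u.
Hypothesis cl_sym : forall u v, (u \in cl v) = (v \in cl u).
Variable ID : V -> nat.
Hypothesis ID_inj : injective ID.
Implicit Types (U : {set V * V}) (B : {set V}) (v : V) (rk : V -> nat).

Local Notation thr := (threshold cl wc).

Definition best U v : {set V} := star cl wc (thr U v) U v.

Definition key_le rk v v' : bool :=
  (rk v < rk v')%N || (rk v == rk v') && (ID v <= ID v')%N.

(** The threshold of [v] is compared with those of all vertices around [p.1], even when their stars
    miss [p]: a pair abstains unless a star of the locally highest level contains it. This makes the
    price of a vote comparable to every star through [p]. *)
Definition votes_for U rk (p : V * V) v : bool :=
  [&& p \in U, 0 < thr U v, p.1 \in best U v, p.2 \in best U v &
   [forall (v' | v' \in cl p.1), (thr U v' <= thr U v) &&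
      ([&& thr U v' == thr U v, p.1 \in best U v' & p.2 \in best U v'] ==>
       key_le rk v v')]].

Definition votes U rk v : {set V * V} := [set p | votes_for U rk p v].

Definition success U rk v : bool :=
  (0 < thr U v) && (#|cov U (best U v)| <= 8 * #|votes U rk v|)%N.

Definition step U rk : {set V * V} :=
  [set p in U | ~~ [exists v, [&& success U rk v, p.1 \in best U v & p.2 \in best U v]]].

Lemma step_sub U rk : step U rk \subset U.
Proof. by apply/subsetP => p; rewrite inE => /andP[]. Qed.

Lemma step_cov U rk v p : success U rk v -> p \in cov U (best U v) -> p \notin step U rk.
Proof.
rewrite !inE => sv /and3P[-> h1 h2]; apply/negPn/existsP; exists v.
by rewrite sv h1.
Qed.

Lemma best_sub U v : best U v \subset cl v.
Proof. exact: star_cl. Qed.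

Lemma votes_cov U rk v : votes U rk v \subset cov U (best U v).
Proof. by apply/subsetP => p; rewrite !inE => /and5P[-> _ -> ->]. Qed.

Lemma votes_for_inj U rk p v v' :
  votes_for U rk p v -> votes_for U rk p v' -> v = v'.
Proof.
case/and5P=> _ _ p1 p2 /forall_inP h; case/and5P=> _ _ p1' p2' /forall_inP h'.
have vc : v \in cl p.1 by rewrite -cl_sym (subsetP (best_sub _ _) _ p1).
have vc' : v' \in cl p.1 by rewrite -cl_sym (subsetP (best_sub _ _) _ p1').
have /andP[l1 k1] := h _ vc'; have /andP[l2 k2] := h' _ vc.
have e : thr U v = thr U v' by apply/eqP; rewrite eq_le l1 l2.
move: k1 k2; rewrite e eqxx p1 p2 p1' p2' /= /key_le => k1 k2.
apply: ID_inj; move: k1 k2; lia.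
Qed.

(** The left side is the price of one vote. The centre [x] of a star through [p] is [p.1] or a
    neighbour of it, so its threshold is at most that of [v], and twice its threshold exceeds the
    density of [B]. *)
Lemma votes_for_le U rk p v x B : weighty cl wc U -> votes_for U rk p v ->
  B \subset cl x -> p \in cov U B ->
  8 / thr U v <= 16 * star_weight wc x B / #|cov U B|%:R.
Proof.
move=> pos /and5P[pU v0 _ _ /forall_inP h] sB pB.
have dB : cov U B != set0 by apply/set0Pn; exists p.
have xc : x \in cl p.1.
  by rewrite -cl_sym; apply: (subsetP sB); move: pB; rewrite inE => /and3P[].
have /andP[le_x _] := h _ xc.
have c0 : 0 < #|cov U B|%:R :> R by rewrite ltr0n card_gt0.
have lt_x := card_cov_lt_threshold wc_ge0 pos sB dB.
rewrite ler_pdivrMr // mulrAC ler_pdivlMr //.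
have : 2 * thr U x * star_weight wc x B <= 2 * thr U v * star_weight wc x B.
  by apply: ler_wpM2r; [exact: (star_weight_ge0 wc_ge0 sB) | lra].
lra.
Qed.

(** A star weighs at most the number of its pairs over its threshold, and at least an eighth of
    these pairs vote for it, each paying 8 over the threshold. *)
Lemma success_weight U rk v : success U rk v ->
  star_weight wc v (best U v) <= \sum_(p in votes U rk v) 8 / thr U v.
Proof.
case/andP=> v0 hv; rewrite sumr_const -[_ *+ _]mulr_natr mulrAC ler_pdivlMr //.
have := star_density cl wc (thr U v) U v; rewrite -/(best U v) mulrC.
by move/le_trans; apply; rewrite -natrM ler_nat.
Qed.

Lemma card_cov_step U rk B :
  #|cov U B :\: step U rk| = (#|cov U B| - #|cov (step U rk) B|)%N.
Proof.
rewrite cardsD; congr (_ - _)%N.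
apply: eq_card => p; rewrite !inE.
by case: (p \in U); case: (p.1 \in B); case: (p.2 \in B); rewrite //= ?andbF ?andbT.
Qed.

(** [O] plays the stars of an optimal spanner. A voter of a successful star becomes covered, votes
    only once, and pays at most [a x] for any star [O x] through it. As [a x] divides by the number
    of uncovered pairs before the step, the payments along [O x] are at most a difference of
    harmonic sums. *)
Lemma step_cost U rk (O : V -> {set V}) : weighty cl wc U ->
  (forall x, O x \subset cl x) ->
  (forall p, p \in U -> exists x, p \in cov U (O x)) ->
  \sum_(v | success U rk v) star_weight wc v (best U v) +
    16 * \sum_x star_weight wc x (O x) * harmonic_sum R #|cov (step U rk) (O x)| <=
  16 * \sum_x star_weight wc x (O x) * harmonic_sum R #|cov U (O x)|.
Proof.
move=> pos sO cO; rewrite addrC -lerBrDl -mulrBr -sumrB.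
pose a x := 16 * star_weight wc x (O x) / #|cov U (O x)|%:R.
have a0 x : 0 <= a x by rewrite /a !mulr_ge0 ?(star_weight_ge0 wc_ge0 (sO x)) ?invr_ge0.
(* One star through [p] would be enough; charging all of them only increases the bound and lets the
   sums be exchanged. *)
pose g p := \sum_(x | p \in cov U (O x)) a x.
have g0 p : 0 <= g p by apply: sumr_ge0.
apply: (@le_trans _ _ (\sum_(v | success U rk v) \sum_(p in votes U rk v) g p)).
  apply: ler_sum => v sv; apply: (le_trans (success_weight sv)).
  apply: ler_sum => p; rewrite inE => pv.
  have [x px] : exists x, p \in cov U (O x) by apply: cO; case/and5P: pv.
  rewrite /g (bigD1 x) //=; apply: (@le_trans _ _ (a x)).
    exact: (votes_for_le pos pv (sO x) px).
  by rewrite lerDl sumr_ge0.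
apply: (@le_trans _ _ (\sum_(p in U :\: step U rk) g p)).
  rewrite (exchange_big_dep xpredT) //= [leRHS]big_mkcond /=.
  apply: ler_sum => p _; case: (pickP (fun v => success U rk v && (p \in votes U rk v))).
    move=> v /andP[sv pv]; rewrite (big_pred1 v) => [|v' /=].
      have pc := subsetP (votes_cov _ _ _) _ pv.
      rewrite inE (step_cov sv pc) /= ifT //.
      exact: (subsetP (cov_sub _ _) _ pc).
    apply/idP/eqP => [/andP[_]|->]; last by rewrite sv.
    by move: pv; rewrite !inE => pv /votes_for_inj; apply.
  by move=> n; rewrite big_pred0 //; case: ifP.
rewrite /g (exchange_big_dep xpredT) //= mulr_sumr.
apply: ler_sum => x _.
rewrite (eq_bigl (fun p => p \in cov U (O x) :\: step U rk)); last first.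
  by move=> p; rewrite !inE; case: (p \in U) => //=; rewrite !(andbT, andbF).
rewrite sumr_const card_cov_step -[_ *+ _]mulr_natr /a.
rewrite -!mulrA ler_pM2l //= -mulrBr ler_wpM2l ?(star_weight_ge0 wc_ge0 (sO x)) // mulrC.
by apply: harmonic_sumB; rewrite subset_leq_card // covS // step_sub.
Qed.

(** Among the vertices of highest threshold, the one of least rank, then of least identifier, gets
    the votes of its whole star, whatever the ranks are. *)
Lemma step_proper U rk : weighty cl wc U ->
  (forall p, p \in U -> exists x, p \in cov U (cl x)) ->
  U != set0 -> step U rk \proper U.
Proof.
move=> pos cU /set0Pn[p0 pU]; have [x0 px0] := cU _ pU.
have [v1 _ max1] := @arg_maxP _ _ _ x0 xpredT (thr U) isT.
have {}max1 v : thr U v <= thr U v1 by exact: max1.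
pose T := [pred v | thr U v == thr U v1].
have [v2 T2 min2] := @arg_minnP _ v1 T rk (eqxx _).
have [v3 /andP[T3 r3] min3] :=
  @arg_minnP _ v2 (fun v => T v && (rk v == rk v2)) ID (introT andP (conj T2 (eqxx _))).
have t3 : thr U v3 = thr U v1 by apply/eqP.
have pos3 : 0 < thr U v3.
  rewrite t3; apply: lt_le_trans (max1 x0).
  by rewrite threshold_gt0 //; apply/set0Pn; exists p0.
have d3 : cov U (best U v3) != set0.
  have c3 : cov U (cl v3) != set0 by rewrite -(threshold_gt0 wc_ge0 _ pos).
  by have [_] := thresholdP wc_ge0 pos c3.
have all3 : votes U rk v3 = cov U (best U v3).
  apply/eqP; rewrite eqEsubset votes_cov; apply/subsetP => p.
  rewrite !inE => /and3P[h0 h1 h2]; apply/and5P; split=> //.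
  apply/forall_inP => v' _; rewrite t3 max1 //=; apply/implyP => /and3P[/eqP e _ _].
  have Tv' : T v' by rewrite /= e.
  rewrite /key_le (eqP r3); have := min2 _ Tv'; rewrite leq_eqVlt.
  case/orP=> [/eqP er|->] //; rewrite er eqxx min3 ?orbT //.
  by rewrite Tv' er /=.
rewrite properE step_sub /=; apply/negP => sub.
case/set0Pn: d3 => p pc; have := subsetP sub p (subsetP (cov_sub _ _) _ pc).
apply/negP; apply: (@step_cov _ _ v3) => //.
by rewrite /success pos3 all3 leq_pmull.
Qed.

End Step.

(** * A potential over the density levels *)

Section Potential.
Variables (R : realType) (V : finType) (cl : V -> {set V}) (wc : V -> V -> R).
Hypothesis wc_ge0 : forall v u, u \in cl v -> 0 <= wc v u.
Variable ID : V -> nat.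
Implicit Types (U : {set V * V}) (v : V) (i : int).

Local Notation thr := (threshold cl wc).
Local Notation step := (step cl wc ID).

(** Built from the fixed density [2 ^ i] instead of the current threshold of [v], so that it is
    monotone in [U]; at the highest level it agrees with the star in use or is empty. *)
Definition level_set i U v : {set V * V} := cov U (star cl wc (2 ^ i) U v).

Definition level_size i U : nat := (\sum_v #|level_set i U v|)%N.

Lemma level_setS i U U' v : U' \subset U -> level_set i U' v \subset level_set i U v.
Proof. by move=> sU; apply: covS => //; apply: starS. Qed.

Lemma level_sizeS i U U' : U' \subset U -> (level_size i U' <= level_size i U)%N.
Proof. by move=> sU; apply: leq_sum => v _; rewrite subset_leq_card // level_setS. Qed.

Lemma level_size_ub i U : (level_size i U <= #|V| ^ 3)%N.
Proof.
rewrite expnS -sum_nat_const; apply: leq_sum => v _.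
by rewrite -mulnn -card_prod max_card.
Qed.

Lemma level_set_eq0 i U v : weighty cl wc U -> thr U v < 2 ^ i -> level_set i U v = set0.
Proof.
move=> pos h; have := not_attains_threshold wc_ge0 pos h (ex_intro _ i erefl).
by move/negPn/eqP.
Qed.

Lemma level_size_eq0 i U : weighty cl wc U -> (forall v, thr U v < 2 ^ i) ->
  level_size i U = 0%N.
Proof. by move=> pos h; apply: big1 => v _; rewrite level_set_eq0 ?cards0. Qed.

Lemma level_size_gt0 i U v : weighty cl wc U -> thr U v = 2 ^ i -> (0 < level_size i U)%N.
Proof.
move=> pos e; rewrite /level_size (bigD1 v) //= addn_gt0 card_gt0.
have d0 : cov U (cl v) != set0 by rewrite -(threshold_gt0 wc_ge0 _ pos) e exprz_gt0.
by have [_] := thresholdP wc_ge0 pos d0; rewrite e /attains => ->.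
Qed.

Lemma level_size_step i U U' : U' \subset U ->
  (level_size i U' + \sum_v #|level_set i U v :\: U'| <= level_size i U)%N.
Proof.
move=> sU; rewrite -big_split; apply: leq_sum => v _.
rewrite -(cardsID U' (level_set i U v)) leq_add2r subset_leq_card //.
by rewrite subsetI level_setS // cov_sub.
Qed.

Section Rank.
Variables (W : finType) (key : W -> nat).
Hypothesis rare_ties : forall u v : V, u != v ->
  (8 * #|V| ^ 2 * #|[set c : {ffun V -> W} | key (c u) == key (c v)]| <= #|{ffun V -> W}|)%N.

Local Notation rank c := (fun v => key (c v)).
Local Notation total := #|{ffun V -> W}|.

(** On the highest level the nonempty level sets are the pairs of the stars in use, and a strict
    minimum among the voters receives the vote without any tie breaking; so election implies success
    and [expected_covered] applies. *)
Lemma expected_level_step i U : weighty cl wc U -> (forall v, thr U v <= 2 ^ i) ->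
  (total * level_size i U <=
   16 * \sum_(c : {ffun V -> W}) \sum_v #|level_set i U v :\: step U (rank c)|)%N.
Proof.
move=> pos top.
have := @expected_covered _ _ _ _ (level_set i U) rare_ties
  (fun c p => p \notin step U (rank c)).
have -> : (\sum_(c : {ffun V -> W}) \sum_v #|level_set i U v :\: step U (rank c)| =
  \sum_(c : {ffun V -> W}) \sum_v #|[set p in level_set i U v | p \notin step U (rank c)]|)%N.
  apply: eq_bigr => c _; apply: eq_bigr => v _; apply: eq_card => p.
  by rewrite !inE andbC.
apply=> c v p pC el.
have e x : level_set i U x != set0 -> thr U x = 2 ^ i.
  move=> d; apply/eqP; rewrite eq_le top /=; exact: attains_threshold.
have ev : thr U v = 2 ^ i by apply: e; apply/set0Pn; exists p.
have eC : level_set i U v = cov U (best cl wc U v) by rewrite /best ev.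
apply: (@step_cov _ _ _ _ _ _ _ v); last by rewrite -eC.
rewrite /success ev exprz_gt0 // -eC; apply: (leq_trans el).
rewrite leq_mul2l /=; apply: subset_leq_card; apply/subsetP => q.
rewrite inE => /andP[qC /forall_inP mn]; move: (qC).
rewrite eC !inE => /and3P[qU q1 q2]; apply/and5P; split=> //.
  by rewrite ev exprz_gt0.
apply/forall_inP => v' _; rewrite ev top /=; apply/implyP => /and3P[/eqP e' h1 h2].
have [->|v'v] := eqVneq v' v; first by rewrite /key_le eqxx leqnn orbT.
move: h1 h2; rewrite /best e' => h1 h2.
by rewrite /key_le mn // !inE v'v qU h1 h2.
Qed.

Local Notation N := (#|V| ^ 3).+1.

(* The levels are weighted so that the highest nonempty one dominates all the
   lower ones, whatever their sizes. *)
Definition potential (i : int) (L : nat) U : nat :=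
  (\sum_(j < L) N ^ j * level_size (i + j%:Z) U)%N.

Lemma potentialS i L U U' : U' \subset U -> (potential i L U' <= potential i L U)%N.
Proof. by move=> sU; apply: leq_sum => j _; rewrite leq_mul2l level_sizeS ?orbT. Qed.

Lemma geometric_lt k : (\sum_(j < k) N ^ j * #|V| ^ 3 < N ^ k)%N.
Proof.
rewrite -big_distrl /= mulnC -[X in (X * _)%N]/(N.-1) -predn_exp.
by rewrite prednK // expn_gt0.
Qed.

Lemma potential_ub i L U : (potential i L U <= N ^ L)%N.
Proof.
apply: leq_trans (ltnW (geometric_lt L)); apply: leq_sum => j _.
by rewrite leq_mul2l level_size_ub orbT.
Qed.

Section TopLevel.
Variables (i : int) (L : nat) (j : 'I_L) (U : {set V * V}) (v : V).
Hypotheses (pos : weighty cl wc U) (top : forall u, thr U u <= 2 ^ (i + j%:Z)).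
Hypothesis topv : thr U v = 2 ^ (i + j%:Z).

Lemma potential_gt0 : (0 < potential i L U)%N.
Proof.
rewrite /potential (bigD1 j) //= addn_gt0 muln_gt0 expn_gt0 /=.
by rewrite (level_size_gt0 pos topv).
Qed.

(** Higher levels are empty, and the lower ones together contribute less than [N ^ j], which a
    single pair on level [j] outweighs. *)
Lemma potential_top : (potential i L U <= 2 * (N ^ j * level_size (i + j%:Z) U))%N.
Proof.
have s0 := level_size_gt0 pos topv.
have hi : (j < L)%N by [].
rewrite /potential -(big_mkord xpredT (fun j => N ^ j * level_size (i + j%:Z) U)%N).
rewrite (big_cat_nat (leq0n j) (ltnW hi)) /= [X in (_ + X)%N]big_ltn //.
have -> : (\sum_(j.+1 <= k < L) N ^ k * level_size (i + k%:Z) U = 0)%N.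
  rewrite big_nat; apply: big1 => k /andP[jk _].
  rewrite level_size_eq0 ?muln0 // => u; apply: le_lt_trans (top u) _.
  by rewrite pow2_lt ltrD2l.
rewrite addn0 mul2n -addnn leq_add2r big_mkord.
apply: (@leq_trans (N ^ j)); last by rewrite leq_pmulr.
apply: leq_trans (ltnW (geometric_lt j)); apply: leq_sum => k _.
by rewrite leq_mul2l level_size_ub orbT.
Qed.

(** The top level loses a sixteenth in expectation, is at least half of the potential, and no other
    level grows: a loss of [1 / 32]. *)
Lemma expected_potential_top :
  (32 * \sum_(c : {ffun V -> W}) potential i L (step U (rank c)) <=
   31 * (total * potential i L U))%N.
Proof.
have h k : (\sum_(c : {ffun V -> W}) level_size k (step U (rank c)) <= total * level_size k U)%N.
  rewrite -sum_nat_const; apply: leq_sum => c _; apply: level_sizeS; exact: step_sub.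
have hj : (16 * \sum_(c : {ffun V -> W}) level_size (i + j%:Z) (step U (rank c)) <=
           15 * (total * level_size (i + j%:Z) U))%N.
  have h1 := expected_level_step pos top.
  have : (\sum_(c : {ffun V -> W}) (level_size (i + j%:Z) (step U (rank c)) +
     \sum_v #|level_set (i + j%:Z) U v :\: step U (rank c)|) <=
     total * level_size (i + j%:Z) U)%N.
    rewrite -sum_nat_const; apply: leq_sum => c _; apply: level_size_step; exact: step_sub.
  rewrite big_split /=; move: h1; set A := (\sum_c level_size _ _)%N.
  by set B := (total * _)%N; set D := (\sum_c _)%N; lia.
have : (16 * \sum_(c : {ffun V -> W}) potential i L (step U (rank c)) +
   total * (N ^ j * level_size (i + j%:Z) U) <= 16 * (total * potential i L U))%N.
  rewrite /potential exchange_big /= !(bigD1 j (P := xpredT)) //= -!big_distrr /=.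
  set A := (\sum_(c : {ffun V -> W}) level_size _ _)%N in hj *.
  set B := level_size _ U in hj *.
  set X := (\sum_(k < L | k != j) \sum_c _)%N; set Y := (\sum_(k < L | k != j) _)%N.
  have : (X <= total * Y)%N.
    rewrite /X /Y big_distrr; apply: leq_sum => k _.
    by rewrite -big_distrr /= mulnCA leq_mul2l h orbT.
  have : (N ^ j * (16 * A) <= N ^ j * (15 * (total * B)))%N by rewrite leq_mul2l hj orbT.
  by set NN := (N ^ j)%N; lia.
have := potential_top; set p := (N ^ j * _)%N; set q := potential i L U; set t := total.
move=> h1; have : (t * q <= t * (2 * p))%N by rewrite leq_mul2l h1 orbT.
lia.
Qed.

End TopLevel.
End Rank.
End Potential.

(** * The covering process on a graph *)

Section Process.
Variables (R : realType) (V : finType) (E : {set {set V}}) (w : {set V} -> R).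
Variable ID : V -> nat.
Hypothesis E_simple : simple_graph E.
Hypothesis w_ge0 : forall e, e \in E -> 0 <= w e.
Hypothesis ID_inj : injective ID.
Implicit Types (u v x : V) (p : V * V) (U : {set V * V}) (H : {set {set V}}).

Definition closed_nbhd H v : {set V} := v |: [set u | adj H v u].

Definition spoke_weight v u : R := if u == v then 0 else w [set v; u].

Definition free_star v : {set V} := v |: [set u | adj E v u & w [set v; u] == 0].

(** Both orientations of an edge are elements, so that each pair can be managed by its first vertex
    alone. *)
Definition uncovered0 : {set V * V} :=
  [set p | adj E p.1 p.2 & ~~ [exists v, (p.1 \in free_star v) && (p.2 \in free_star v)]].

Local Notation cl := (closed_nbhd E).
Local Notation step := (step cl spoke_weight ID).
Local Notation success := (success cl spoke_weight ID).
Local Notation best := (best cl spoke_weight).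

Variable rank : nat -> V -> nat.

Fixpoint uncovered k : {set V * V} :=
  if k is k'.+1 then step (uncovered k') (rank k') else uncovered0.

Fixpoint chosen k v : {set V} :=
  if k is k'.+1 then
    chosen k' v :|: (if success (uncovered k') (rank k') v
                     then best (uncovered k') v :\ v else set0)
  else free_star v :\ v.

Lemma adj_sym H u v : adj H u v = adj H v u.
Proof. by rewrite /adj setUC. Qed.

Lemma adj_irrefl v : adj E v v = false.
Proof.
by apply/negP => /E_simple; rewrite setUid cards1.
Qed.

Lemma closed_nbhd_sym H u v : (u \in closed_nbhd H v) = (v \in closed_nbhd H u).
Proof. by rewrite !inE eq_sym adj_sym. Qed.

Lemma closed_nbhd_refl H v : v \in closed_nbhd H v.
Proof. by rewrite !inE eqxx. Qed.

Lemma spoke_weight_ge0 v u : u \in cl v -> 0 <= spoke_weight v u.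
Proof.
by rewrite !inE /spoke_weight; case: eqP => //= _ /w_ge0.
Qed.

Lemma free_star_sub v : free_star v \subset cl v.
Proof.
by apply/subsetP => u; rewrite !inE; case: eqP => //= _ /andP[].
Qed.

Lemma uncoveredS k : uncovered k.+1 \subset uncovered k.
Proof. exact: step_sub. Qed.

Lemma uncovered_sub k : uncovered k \subset uncovered0.
Proof.
elim: k => //= k; apply: subset_trans; exact: uncoveredS.
Qed.

Lemma uncovered0_adj p : p \in uncovered0 -> adj E p.1 p.2.
Proof. by rewrite inE => /andP[]. Qed.

(** A star of weight 0 is contained in the free star of its centre, whose pairs have been
    removed. *)
Lemma weighty_uncovered0 : weighty cl spoke_weight uncovered0.
Proof.
move=> v B sB /set0Pn[p].
rewrite inE => /and3P[pU p1 p2]; rewrite lt_neqAle (star_weight_ge0 spoke_weight_ge0 sB) andbT.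
apply/negP => /eqP/esym/eqP; rewrite psumr_eq0 => [|u /(subsetP sB)]; last exact: spoke_weight_ge0.
move=> /allP z; have inF u : u \in B -> u \in free_star v.
  move=> uB; have := subsetP sB _ uB; have := z _ (mem_index_enum u); rewrite uB /=.
  by rewrite /spoke_weight !inE; case: (eqVneq u v) => //= _ -> ->.
move: pU; rewrite inE => /andP[_ /negP]; apply; apply/existsP; exists v.
by rewrite !inF.
Qed.

Lemma weighty_uncovered k : weighty cl spoke_weight (uncovered k).
Proof. exact: weightyS (uncovered_sub k) weighty_uncovered0. Qed.

Lemma cov_closed_nbhd k p : p \in uncovered k -> p \in cov (uncovered k) (cl p.1).
Proof.
move=> pU; rewrite inE pU closed_nbhd_refl !inE uncovered0_adj ?orbT //.
exact: (subsetP (uncovered_sub k)).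
Qed.

Lemma uncovered_eq0 : exists k, uncovered k = set0.
Proof.
have h k : (#|uncovered k| <= #|uncovered0| - k)%N \/ uncovered k = set0.
  elim: k => [|k [IH|IH]]; first by left; rewrite subn0.
    have [e0|n0] := eqVneq (uncovered k) set0.
      by right; have := uncoveredS k; rewrite e0 subset0 => /eqP.
    have cU p : p \in uncovered k -> exists x, p \in cov (uncovered k) (cl x).
      by move/cov_closed_nbhd; exists p.1.
    left; have lt : (#|uncovered k.+1| < #|uncovered k|)%N :=
      proper_card (step_proper spoke_weight_ge0 ID (rank k) (@weighty_uncovered k) cU n0).
    by lia.
  by right; have := uncoveredS k; rewrite IH subset0 => /eqP.
exists #|uncovered0|; case: (h #|uncovered0|) => // {h}.
by rewrite subnn leqn0 cards_eq0 => /eqP.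
Qed.

Lemma uncovered_stop k l : uncovered k = set0 -> (k <= l)%N -> uncovered l = set0.
Proof.
move=> e /subnK <-; elim: (l - k)%N => // m IH.
by have := uncoveredS (m + k); rewrite IH subset0 => /eqP.
Qed.

Lemma chosenP k v u : u \in chosen k v -> adj E v u.
Proof.
elim: k => [|k IH] /=.
  by rewrite !inE => /andP[/negPf->] /= /andP[].
rewrite inE => /orP[//|]; case: ifP => _; last by rewrite inE.
rewrite !inE => /andP[uv ub]; have := subsetP (best_sub _ _ _ _) _ ub.
by rewrite !inE (negPf uv).
Qed.

Lemma uncovered_or_chosen k p : adj E p.1 p.2 ->
  p \in uncovered k \/ exists v, (p.1 \in v |: chosen k v) && (p.2 \in v |: chosen k v).
Proof.
move=> ap; elim: k => [|k [IH|[v IH]]].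
- case: (boolP (p \in uncovered0)); [by left|rewrite inE ap /= negbK => /existsP[v hv]].
  by right; exists v; rewrite /= setD1K ?setU11.
- case: (boolP (p \in uncovered k.+1)); [by left|rewrite inE IH /= negbK].
  case/existsP => v /and3P[sv b1 b2]; right; exists v.
  rewrite sv !in_setU1 !in_setU !in_setD1 b1 b2.
  by case: (p.1 == v); case: (p.2 == v); rewrite /= ?orbT.
right; exists v; case/andP: IH; rewrite !in_setU1 /= !in_setU.
by move=> /orP[->|->] /orP[->|->]; rewrite ?orbT.
Qed.

Definition chosen_graph k : {set {set V}} :=
  [set [set p.1; p.2] | p in [set p | p.2 \in chosen k p.1]].

Lemma chosen_graph_edge k v u : u \in chosen k v -> adj (chosen_graph k) v u.
Proof. by move=> h; apply/imsetP; exists (v, u); rewrite ?inE. Qed.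

Lemma chosen_graph_sub k : chosen_graph k \subset E.
Proof. by apply/subsetP => e /imsetP[p]; rewrite inE => /chosenP h ->. Qed.

Lemma chosen_graph_spanner k : uncovered k = set0 -> is_spanner 2 E (chosen_graph k).
Proof.
move=> U0; split; first exact: chosen_graph_sub.
move=> u v uv; have [|[x]] := @uncovered_or_chosen k (u, v) uv; first by rewrite U0 inE.
rewrite /= !in_setU1 => /andP[/predU1P[eu|xu] /predU1P[ev|xv]].
- by move: uv; rewrite eu ev adj_irrefl.
- by exists [:: v]; split=> //=; rewrite eu chosen_graph_edge.
- by exists [:: v]; split=> //=; rewrite ev adj_sym chosen_graph_edge.
by exists [:: x; v]; split=> //=; rewrite adj_sym !chosen_graph_edge.
Qed.

(** Only an inequality, since an edge may be chosen from both ends. *)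
Lemma cost_chosen_graph k :
  cost w (chosen_graph k) <= \sum_v star_weight spoke_weight v (chosen k v).
Proof.
pose P := [set p : V * V | p.2 \in chosen k p.1].
have -> : \sum_v star_weight spoke_weight v (chosen k v) = \sum_(p in P) w [set p.1; p.2].
  rewrite /star_weight (pair_big_dep xpredT (fun v u => u \in chosen k v)) /=.
  apply: eq_big => [p|p /chosenP h]; first by rewrite inE.
  by rewrite /spoke_weight; case: eqP h => [->|//]; rewrite adj_irrefl.
rewrite (partition_big_imset (fun p => [set p.1; p.2])) /=.
apply: ler_sum => e /imsetP[p pP ->]; rewrite (bigD1 p) ?pP ?eqxx //= lerDl.
apply: sumr_ge0 => q /andP[/andP[qP _] _]; apply: w_ge0.
by move: qP; rewrite inE => /chosenP.
Qed.

(** * Comparison with an arbitrary 2-spanner *)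

Section Approximation.
Variable H : {set {set V}}.
Hypothesis H_spanner : is_spanner 2 E H.

Lemma spanner_adj u v : adj H u v -> adj E u v.
Proof. by case: H_spanner => /subsetP sH _ /sH. Qed.

Lemma spanner_star v : closed_nbhd H v \subset cl v.
Proof.
by apply/subsetP => u; rewrite !inE => /orP[->|/spanner_adj ->]; rewrite ?orbT.
Qed.

(** The centre is the middle vertex of a path of two edges, or [p.1] if the edge itself is in [H];
    the empty path would be a loop. *)
Lemma spanner_cov k p : p \in uncovered k ->
  exists x, p \in cov (uncovered k) (closed_nbhd H x).
Proof.
move=> pU; have ap := uncovered0_adj (subsetP (uncovered_sub k) _ pU).
case: H_spanner => _ /(_ _ _ ap) [[|x [|y [|z s]]]] [] //=.
- by move=> _ e; move: ap; rewrite e adj_irrefl.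
- by rewrite andbT => h e _; exists p.1; rewrite !inE pU eqxx -e h orbT.
by case/and3P => h1 h2 _ e _; exists x; rewrite !inE pU adj_sym h1 -e h2 !orbT.
Qed.

(** An edge [e] is counted once for each ordered pair that spans it; the 4 is the size of
    [setX e e]. *)
Lemma spanner_star_weight :
  \sum_x star_weight spoke_weight x (closed_nbhd H x) <= 4 * cost w H.
Proof.
have sH : H \subset E by case: H_spanner.
have -> : \sum_x star_weight spoke_weight x (closed_nbhd H x) =
  \sum_(q : V * V | adj H q.1 q.2) w [set q.1; q.2].
  rewrite /star_weight (pair_big_dep xpredT (fun x u => u \in closed_nbhd H x)) /=.
  rewrite big_mkcond [RHS]big_mkcond; apply: eq_bigr => -[x u] _ /=.
  rewrite !inE /spoke_weight; case: eqP => //= ->.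
  by case: ifP => // /spanner_adj; rewrite adj_irrefl.
rewrite (partition_big (fun q => [set q.1; q.2]) (mem H)) //=.
rewrite /cost mulr_sumr; apply: ler_sum => e eH.
rewrite (eq_bigr (fun=> w e)) => [|q /andP[_ /eqP ->] //].
rewrite sumr_const -[_ *+ _]mulr_natl ler_wpM2r ?w_ge0 ?(subsetP sH) //.
rewrite ler_nat; apply: (@leq_trans #|[set q : V * V | (q.1 \in e) && (q.2 \in e)]|).
  by apply: subset_leq_card; apply/subsetP => q; rewrite !inE => /andP[_ /eqP<-];
    rewrite !inE !eqxx orbT.
have <- : #|setX e e| = 4%N by rewrite cardsX (E_simple (subsetP sH _ eH)).
by apply: subset_leq_card; apply/subsetP => q; rewrite !inE.
Qed.

Lemma chosen_weight k :
  \sum_v star_weight spoke_weight v (chosen k v) +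
    16 * \sum_x star_weight spoke_weight x (closed_nbhd H x) *
      harmonic_sum R #|cov (uncovered k) (closed_nbhd H x)| <=
  16 * \sum_x star_weight spoke_weight x (closed_nbhd H x) *
      harmonic_sum R #|cov uncovered0 (closed_nbhd H x)|.
Proof.
elim: k => [|k IH] /=.
  rewrite big1 ?add0r // => v _; apply: big1 => u; rewrite !inE /spoke_weight.
  by case: eqP => //= _ /andP[_ /eqP].
apply: le_trans IH.
apply: (le_trans _ (lerD (lexx _) (step_cost spoke_weight_ge0 (closed_nbhd_sym E) ID_inj
   (rank k) (@weighty_uncovered k) spanner_star (@spanner_cov k)))).
rewrite addrA lerD2r [X in _ <= _ + X]big_mkcond -big_split /=.
apply: ler_sum => v _; case: ifP => sv; last by rewrite setU0 addr0.
set A := chosen k v; set B := _ :\ v.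
have sA : A \subset cl v by apply/subsetP => u /chosenP; rewrite !inE => ->; rewrite orbT.
have sB : best (uncovered k) v \subset cl v by apply: best_sub.
have sB' : B \subset best (uncovered k) v by apply: subsetDl.
have := star_weightUI spoke_weight v A B.
have := star_weight_ge0 spoke_weight_ge0 (subset_trans (subsetIl A B) sA).
have : star_weight spoke_weight v B <= star_weight spoke_weight v (best (uncovered k) v).
  rewrite /star_weight [leRHS](big_setID B) /= (setIidPr sB') lerDl.
  by apply: sumr_ge0 => u; rewrite inE => /andP[_ /(subsetP sB)/spoke_weight_ge0].
lra.
Qed.

Lemma card_closed_nbhd v : (#|cl v| <= (max_degree E).+1)%N.
Proof.
rewrite cardsU1 (leq_trans (leq_add (leq_b1 _) (leqnn _))) // ltnS.
exact: (leq_bigmax v).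
Qed.

(** A star has at most [(max_degree E).+1 ^ 2] ordered pairs, and [64 = 16 * 4], from
    [chosen_weight] and [spanner_star_weight]. *)
Lemma cost_chosen_graph_le k :
  cost w (chosen_graph k) <= 64 * harmonic_sum R ((max_degree E).+1 ^ 2) * cost w H.
Proof.
apply: (le_trans (cost_chosen_graph k)).
have h := chosen_weight k.
set h1 := \sum_v _; set K := harmonic_sum _ _.
have w0 x : 0 <= star_weight spoke_weight x (closed_nbhd H x).
  exact: (star_weight_ge0 spoke_weight_ge0 (spanner_star x)).
have p0 : 0 <= 16 * \sum_x star_weight spoke_weight x (closed_nbhd H x) *
      harmonic_sum R #|cov (uncovered k) (closed_nbhd H x)|.
  by rewrite mulr_ge0 // sumr_ge0 // => x _; rewrite mulr_ge0 ?harmonic_sum_ge0.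
apply: (@le_trans _ _ (16 * \sum_x star_weight spoke_weight x (closed_nbhd H x) * K)).
  apply: (@le_trans _ _ (16 * \sum_x star_weight spoke_weight x (closed_nbhd H x) *
      harmonic_sum R #|cov uncovered0 (closed_nbhd H x)|)).
    by apply: le_trans h; rewrite lerDl.
  rewrite ler_pM2l //; apply: ler_sum => x _; rewrite ler_wpM2l //.
  apply: harmonic_sum_le; rewrite -mulnn; apply: (@leq_trans (#|cl x| * #|cl x|)).
    rewrite -cardsX; apply: subset_leq_card; apply/subsetP => p; rewrite inE => /and3P[_ p1 p2].
    by rewrite inE !(subsetP (spanner_star x)).
  by rewrite leq_mul ?card_closed_nbhd.
rewrite -mulr_suml mulrA.
have -> : 64 * K * cost w H = 16 * (4 * cost w H) * K by ring.
by rewrite ler_wpM2r ?harmonic_sum_ge0 // ler_pM2l // spanner_star_weight.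
Qed.

End Approximation.
End Process.

(** * Ties between random ranks *)

Section RandomRanks.
Variables (V : finType) (N : nat).

Local Notation word := {ffun 'I_N.+1 -> bool}.

(* Comparing the codes of the words of [k] bits, rather than the words, is
   immaterial: only ties matter. *)
Definition rank_code (k : nat) (b : nat -> bool) : nat := pickle (mkseq b k).

Definition word_key (k : nat) (a : word) : nat := rank_code k (fun j => a (inord j)).

Lemma word_key_inj k (a b : word) (j : 'I_N.+1) :
  word_key k a = word_key k b -> (j < k)%N -> a j = b j.
Proof.
move=> /(pcan_inj (@pickleK _)) e jk; have := congr1 (nth false ^~ j) e.
by rewrite !nth_mkseq // inord_val.
Qed.

(** Adding any [z] modulo 2 to the first [k] bits of the word of [v] is injective on tied
    assignments: the tie lets the original bits be read off the word of [u], which is unchanged. So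
    every tie accounts for [2 ^ k] assignments. *)
Lemma card_ties k (u v : V) : (k <= N.+1)%N -> u != v ->
  (2 ^ k * #|[set c : {ffun V -> word} | word_key k (c u) == word_key k (c v)]| <=
   #|{ffun V -> word}|)%N.
Proof.
move=> kN uv; set A := [set c | _].
pose f (q : {ffun V -> word} * {ffun 'I_k -> bool}) : {ffun V -> word} :=
  [ffun x => if x == v then [ffun j : 'I_N.+1 =>
     if insub (j : nat) is Some l then q.1 v j (+) q.2 l else q.1 v j] else q.1 x].
have f_inj : {in setX A setT &, injective f}.
  move=> [c z] [c' z']; rewrite !inE !andbT /= => /eqP cA /eqP cA' e.
  have ex x : x != v -> c x = c' x.
    by move=> xv; have := congr1 (fun g : {ffun V -> word} => g x) e; rewrite !ffunE (negPf xv).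
  have ev (j : 'I_N.+1) : (if insub (j : nat) is Some l then c v j (+) z l else c v j) =
              (if insub (j : nat) is Some l then c' v j (+) z' l else c' v j).
    by have := congr1 (fun g : {ffun V -> word} => g v j) e; rewrite !ffunE eqxx !ffunE.
  have cv j : c v j = c' v j.
    have := ev j; case: insubP => // l jk _ _.
    by rewrite -(word_key_inj cA jk) -(word_key_inj cA' jk) ex.
  congr (_, _).
    by apply/ffunP => x; case: (eqVneq x v) => [->|/ex //]; apply/ffunP => j.
  apply/ffunP => l; have lN : (l < N.+1)%N := leq_trans (ltn_ord l) kN.
  have := ev (Ordinal lN); rewrite insubT //= => lk.
  by rewrite -cv (_ : Sub _ _ = l); [move/addbI | apply: val_inj].
have -> : (2 ^ k = #|[set: {ffun 'I_k -> bool}]|)%N.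
  by rewrite cardsT card_ffun card_bool card_ord.
rewrite mulnC -cardsX -(card_in_imset f_inj); exact: max_card.
Qed.

End RandomRanks.

Lemma big_tuple_cons (X : finType) m (F : m.+1.-tuple X -> nat) :
  (\sum_s F s = \sum_(c : X) \sum_(s : m.-tuple X) F [tuple of c :: s])%N.
Proof.
rewrite pair_big /= (reindex (fun q : X * m.-tuple X => [tuple of q.1 :: q.2])) //=.
exists (fun s : m.+1.-tuple X => (thead s, [tuple of behead s])) => [[c s] _|s _] /=.
  by congr (_, _); apply: val_inj.
by rewrite -tuple_eta.
Qed.

(** * Decay of the potential along a random run *)

Section Run.
Variables (R : realType) (V : finType) (cl : V -> {set V}) (wc : V -> V -> R).
Hypothesis wc_ge0 : forall v u, u \in cl v -> 0 <= wc v u.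
Variable ID : V -> nat.
Variables (N : nat) (U0 : {set V * V}) (i : int) (L k0 : nat).
Hypothesis U0_weighty : weighty cl wc U0.
Hypothesis levels_lb : forall U : {set V * V}, U \subset U0 -> U != set0 ->
  exists v, attains cl wc (2 ^ i) U v.
Hypothesis levels_ub : forall v c, 0 <= c -> attains cl wc c U0 v -> c < 2 ^ (i + L%:Z).
Hypothesis k0_large : (8 * #|V| ^ 2 <= 2 ^ k0)%N.
Implicit Types (U : {set V * V}).

Local Notation word := {ffun 'I_N.+1 -> bool}.
Local Notation sample := {ffun V -> word}.
Local Notation step := (step cl wc ID).
Local Notation rank k c := (fun v => word_key k (c v)).
Local Notation pot := (potential cl wc i L).
Local Notation thr := (threshold cl wc).

(** [k] is both the number of the iteration and the number of bits read; every sample supplies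
    [N.+1] bits per vertex, so that all iterations have the same sample space. *)
Fixpoint run (k : nat) U (s : seq sample) : {set V * V} :=
  if s is c :: s' then run k.+1 (step U (rank k c)) s' else U.

Lemma run_sub k U (s : seq sample) : run k U s \subset U.
Proof.
elim: s k U => [|c s IH] k U //=; exact: subset_trans (IH _ _) (step_sub _ _ _ _ _).
Qed.

Lemma top_level U : U \subset U0 -> U != set0 ->
  exists v (j : 'I_L), (forall u, thr U u <= 2 ^ (i + j%:Z)) /\ thr U v = 2 ^ (i + j%:Z).
Proof.
move=> sU n0; have [v0 d0] := levels_lb sU n0; have pos := weightyS sU U0_weighty.
have [v _ max_v] := @arg_maxP _ _ _ v0 xpredT (thr U) isT.
have {}max_v u : thr U u <= thr U v by exact: max_v.
have iv : 2 ^ i <= thr U v := le_trans (attains_threshold wc_ge0 pos d0) (max_v v0).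
have tv : 0 < thr U v by apply: lt_le_trans iv; rewrite exprz_gt0.
rewrite threshold_gt0 // in tv; have [[z ez] dz _] := thresholdP wc_ge0 pos tv.
have zu : z < i + L%:Z.
  rewrite -(pow2_lt R) -ez; apply: (@levels_ub v); first exact: threshold_ge0.
  by apply: (attainsS wc_ge0 _ sU dz); rewrite lexx threshold_ge0.
have iz : i <= z by rewrite ez ler_eXz2l ?ltr1n // in iv.
have ej : z = i + `|z - i|%N%:Z by lia.
have jL : (`|z - i| < L)%N by lia.
by exists v, (Ordinal jL); split; [move=> u|]; rewrite /= -ej -ez.
Qed.

Lemma potential_set0 : pot set0 = 0%N.
Proof.
apply: big1 => j _; rewrite (_ : level_size _ _ _ _ = 0)%N ?muln0 //.
apply: big1 => v _; apply/eqP; rewrite cards_eq0 -subset0; exact: cov_sub.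
Qed.

Lemma expected_potential_step k U : (k0 <= k <= N.+1)%N -> U \subset U0 ->
  (32 * \sum_(c : sample) pot (step U (rank k c)) <= 31 * (#|{: sample}| * pot U))%N.
Proof.
case/andP=> k0k kN sU; have [->|n0] := eqVneq U set0.
  rewrite big1 // => c _; rewrite (_ : step _ _ = set0) ?potential_set0 //.
  by apply/eqP; rewrite -subset0 step_sub.
have [v [j [top topv]]] := top_level sU n0.
apply: (expected_potential_top wc_ge0 _ _ (weightyS sU U0_weighty) top topv) => u x ux.
apply: leq_trans (card_ties kN ux); rewrite leq_mul2r; apply/orP; right.
by apply: (leq_trans k0_large); rewrite leq_exp2l.
Qed.

Lemma expected_run_late m k U : (k0 <= k)%N -> (k + m <= N.+1)%N -> U \subset U0 ->
  (32 ^ m * \sum_(s : m.-tuple sample) pot (run k U s) <=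
   31 ^ m * (#|{: sample}| ^ m * pot U))%N.
Proof.
elim: m k U => [|m IH] k U k0k kN sU.
  rewrite !expn0 !mul1n (bigD1 [tuple]) //= big1 ?addn0 // => s /eqP[].
  exact: tuple0.
rewrite big_tuple_cons /= expnSr -mulnA.
apply: (@leq_trans (32 * \sum_(c : sample) (31 ^ m *
    (#|{: sample}| ^ m * pot (step U (rank k c)))))).
  rewrite mulnCA leq_mul2l /= big_distrr; apply: leq_sum => c _.
  by apply: IH; [exact: leqW | rewrite addSnnS | exact: subset_trans (step_sub _ _ _ _ _) sU].
rewrite -!big_distrr /= (mulnC 32) -!mulnA (mulnC _ 32) expnSr -!mulnA leq_mul2l.
rewrite [(31 * _)%N]mulnCA expnSr -!mulnA leq_mul2l; apply/orP; right; apply/orP; right.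
rewrite mulnCA; apply: expected_potential_step => //.
by rewrite k0k ltnW // (leq_trans _ kN) // addnS ltnS leq_addr.
Qed.

(** During the first [j] iterations ties may be frequent; nothing is gained there, but the potential
    does not grow. *)
Lemma expected_run m j k U : (k + j = k0)%N -> (k0 + m <= N.+1)%N -> U \subset U0 ->
  (32 ^ m * \sum_(s : (j + m).-tuple sample) pot (run k U s) <=
   31 ^ m * (#|{: sample}| ^ (j + m) * pot U))%N.
Proof.
elim: j k U => [|j IH] k U kj kN sU; first by apply: expected_run_late; lia.
rewrite big_tuple_cons /= big_distrr /=.
apply: (@leq_trans (\sum_(c : sample) 31 ^ m * (#|{: sample}| ^ (j + m) * pot U))%N).
  apply: leq_sum => c _.
  apply: (@leq_trans (31 ^ m * (#|{: sample}| ^ (j + m) * pot (step U (rank k c))))).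
    apply: IH => //; first by rewrite addSnnS.
    exact: subset_trans (step_sub _ _ _ _ _) sU.
  by rewrite !leq_mul2l potentialS ?step_sub ?orbT.
by rewrite sum_nat_const addSn expnS mulnCA -!mulnA.
Qed.

(** Markov's inequality: the potential is an integer, positive as long as a pair is uncovered. *)
Lemma card_run_late m : (k0 + m <= N.+1)%N ->
  (32 ^ m * #|[set s : (k0 + m).-tuple sample | run 0 U0 s != set0]| <=
   31 ^ m * (#|{: sample}| ^ (k0 + m) * (#|V| ^ 3).+1 ^ L))%N.
Proof.
move=> kN; apply: (@leq_trans (32 ^ m * \sum_(s : (k0 + m).-tuple sample) pot (run 0 U0 s))).
  rewrite leq_mul2l -sum1_card big_mkcond; apply/orP; right; apply: leq_sum => s _.
  rewrite inE; case: ifP => // n0.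
  have sR := run_sub 0 U0 s.
  have [v [j [top topv]]] := top_level sR n0.
  exact: (potential_gt0 wc_ge0 (weightyS sR U0_weighty) topv).
apply: (leq_trans (expected_run (j := k0) (k := 0) _ kN (subxx _))) => //.
by rewrite !leq_mul2l potential_ub !orbT.
Qed.

End Run.

(* Imported only now because it shadows the lemmas on finite sets. *)
From mathcomp Require Import all_classical all_reals all_analysis.
Local Open Scope ring_scope.

(** * The message-passing algorithm *)

(** A message is the whole state. Nodes do not know [V], so sets of vertices are predicates on
    identifiers; [node_open] holds the uncovered pairs whose first vertex is the node. *)
Record node (R : realType) := Node {
  node_id : nat;
  node_view : seq (nat * R);
  node_tape : nat -> bool;
  node_phase : nat;
  node_iter : nat;
  node_open : nat -> bool;
  node_threshold : R;
  node_star : nat -> bool;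
  node_vote : nat -> nat -> bool;
  node_added : nat -> bool;
  node_chosen : nat -> bool;
  node_halted : bool
}.

Section LocalAlgorithm.
Variable R : realType.
Implicit Types (s : node R) (l : seq (nat * node R)) (a : nat -> bool) (c : R).

Definition local_cov l a : nat :=
  (\sum_(m <- l) \sum_(m' <- l) [&& node_open m.2 m'.1, a m.1 & a m'.1])%N.

Definition local_weight (view : seq (nat * R)) a : R :=
  \sum_(p <- view) if a p.1 then p.2 else 0.

Definition local_gain c view l a : R :=
  (local_cov l a)%:R - c * local_weight view a.

(** The union of the maximizers among all predicates on identifiers. The gain only depends on
    identifiers in the closed neighbourhood, so restricting the union to the inbox gives [star]. *)
Definition local_star c view l : nat -> bool := fun i =>
  (i \in [seq m.1 | m <- l]) &&
  `[< exists a, (forall b, local_gain c view l b <= local_gain c view l a) /\ a i >].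

Definition local_attains c view l : bool := (0 < local_cov l (local_star c view l))%N.

Definition local_threshold view l : R := classical_sets.xget 0 (fun c =>
  (exists i : int, c = 2 ^ i) /\ local_attains c view l /\ ~~ local_attains (2 * c) view l).

(* The tape stores the [j]-th bit of the [k]-th rank at position [pickle (k, j)]. *)
Definition node_rank s : nat :=
  rank_code (node_iter s) (fun j => node_tape s (pickle (node_iter s, j))).

Definition node_key_le (m m' : nat * node R) : bool :=
  (node_rank m.2 < node_rank m'.2)%N ||
  (node_rank m.2 == node_rank m'.2) && (m.1 <= m'.1)%N.

Definition local_vote s l : nat -> nat -> bool := fun y v =>
  node_open s y &&
  has (fun m => [&& m.1 == v, 0 < node_threshold m.2,
     node_star m.2 (node_id s), node_star m.2 y &
     all (fun m' => (node_threshold m'.2 <= node_threshold m.2) &&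
        ([&& node_threshold m'.2 == node_threshold m.2,
             node_star m'.2 (node_id s) & node_star m'.2 y] ==> node_key_le m m')) l]) l.

Definition local_success s l : bool :=
  (0 < node_threshold s) &&
  (local_cov l (node_star s) <=
   8 * \sum_(m <- l) \sum_(m' <- l) node_vote m.2 m'.1 (node_id s))%N.

Definition local_open s l : nat -> bool := fun y =>
  node_open s y && ~~ has (fun m => node_added m.2 (node_id s) && node_added m.2 y) l.

(* An iteration takes four rounds: stars are built from the uncovered pairs,
   pairs vote for stars, votes are counted, covered pairs are removed. *)
Definition local_update s l : node R :=
  let next ph it := Node (node_id s) (node_view s) (node_tape s) ph it in
  let it := node_iter s in
  match node_phase s with
  | 0%N => let c := local_threshold (node_view s) l in
      next 1%N it (node_open s) c (local_star c (node_view s) l)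
        (fun _ _ => false) (fun _ => false) (node_chosen s) (c == 0)
  | 1%N => next 2%N it (node_open s) (node_threshold s) (node_star s)
        (local_vote s l) (node_added s) (node_chosen s) false
  | 2%N => let new := fun i => local_success s l && node_star s i in
      next 3%N it.+1 (node_open s) (node_threshold s) (node_star s) (node_vote s)
        new (fun i => node_chosen s i || new i && (i != node_id s)) false
  | _ => next 0%N it (local_open s l) (node_threshold s) (node_star s) (node_vote s)
        (node_added s) (node_chosen s) false
  end.

(* Phase 3 comes first: it removes the pairs covered by edges of weight 0, which
   are chosen from the start. *)
Definition node_init (id : nat) (view : seq (nat * R)) (tape : nat -> bool) : node R :=
  let free i := (i == id) || ((i, 0) \in view) in
  Node id view tape 3 0 (fun i => i \in [seq p.1 | p <- view]) 0 (fun _ => false)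
    (fun _ _ => false) free (fun i => free i && (i != id)) false.

Definition spanner_algorithm : local_algorithm R := {|
  state := node R;
  message := node R;
  init := node_init;
  send := fun s _ => s;
  recv := fun s l => local_update s ((node_id s, s) :: l);
  output := fun s =>
    if node_halted s then Some [seq i <- [seq p.1 | p <- node_view s] | node_chosen s i]
    else None
|}.

End LocalAlgorithm.

(** * The algorithm simulates the covering process *)

Section Simulation.
Variables (R : realType) (V : finType) (E : {set {set V}}) (w : {set V} -> R).
Variables (ID : V -> nat) (tape : V -> nat -> bool).
Hypothesis E_simple : simple_graph E.
Hypothesis w_ge0 : forall e, e \in E -> 0 <= w e.
Hypothesis ID_inj : injective ID.
Implicit Types (u v x y : V) (U : {set V * V}) (k t : nat).

Local Notation cl := (closed_nbhd E).
Local Notation wc := (spoke_weight w).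
Local Notation A := (spanner_algorithm R).

Definition tape_rank k v : nat := rank_code k (fun j => tape v (pickle (k, j))).

Local Notation U k := (uncovered E w ID tape_rank k).
Local Notation S t v := (states_at A E w ID tape t v).

Definition closed_seq v : seq V := v :: neighbours E ID v.

Lemma mem_neighbours v u : (u \in neighbours E ID v) = adj E v u.
Proof. by rewrite mem_sort mem_filter mem_enum andbT. Qed.

Lemma uniq_neighbours v : uniq (neighbours E ID v).
Proof. by rewrite sort_uniq filter_uniq // enum_uniq. Qed.

Lemma mem_closed_seq v u : (u \in closed_seq v) = (u \in cl v).
Proof. by rewrite in_cons mem_neighbours /closed_nbhd finset.in_setU1 finset.in_set. Qed.

Lemma uniq_closed_seq v : uniq (closed_seq v).
Proof. by rewrite /= uniq_neighbours mem_neighbours adj_irrefl. Qed.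

Lemma sum_closed_seq v (F : V -> nat) : (\sum_(x <- closed_seq v) F x = \sum_(x in cl v) F x)%N.
Proof.
by rewrite big_uniq ?uniq_closed_seq //; apply: eq_bigl => x; rewrite mem_closed_seq.
Qed.

Definition inbox t v : seq (nat * node R) := [seq (ID u, S t u) | u <- closed_seq v].

Lemma has_inbox t v (f : pred (nat * node R)) :
  has f (inbox t v) = [exists (x | x \in cl v), f (ID x, S t x)].
Proof.
rewrite has_map; apply/hasP/exists_inP => [[x xv fx]|[x xv fx]]; exists x => //.
  by rewrite -mem_closed_seq.
by rewrite mem_closed_seq.
Qed.

Lemma all_inbox t v (f : pred (nat * node R)) :
  all f (inbox t v) = [forall (x | x \in cl v), f (ID x, S t x)].
Proof.
rewrite all_map; apply/allP/forall_inP => h x xv; apply: h.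
  by rewrite mem_closed_seq.
by rewrite -mem_closed_seq.
Qed.

Lemma states_atS t v : node_id (S t v) = ID v ->
  S t.+1 v = if node_halted (S t v) then S t v else local_update (S t v) (inbox t v).
Proof. by move=> e /=; case: node_halted => //=; rewrite e. Qed.

Definition pred_set (B : {set V}) (i : nat) : bool := [exists u, (ID u == i) && (u \in B)].

Lemma pred_setE B u : pred_set B (ID u) = (u \in B).
Proof.
apply/existsP/idP => [[x /andP[/eqP/ID_inj -> //]]|uB].
by exists u; rewrite eqxx.
Qed.

Section Star.
Variables (t : nat) (O : {set V * V}) (v : V).
Hypothesis openO : forall x y, node_open (S t x) (ID y) = ((x, y) \in O).

Lemma local_covE (a : nat -> bool) :
  local_cov (inbox t v) a = #|cov O [set u in cl v | a (ID u)]|.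
Proof.
rewrite /local_cov /inbox big_map sum_closed_seq.
under eq_bigr do rewrite big_map sum_closed_seq.
rewrite pair_big_dep -sum1_card big_mkcond [RHS]big_mkcond.
apply: eq_bigr => -[x y] _ /=; rewrite openO !finset.in_set /=.
by case: (_ || _); case: (_ || _); case: (_ \in O); case: (a _); case: (a _).
Qed.

Lemma local_weightE (a : nat -> bool) :
  local_weight (view E w ID v) a = star_weight wc v [set u in cl v | a (ID u)].
Proof.
rewrite /local_weight /view big_map /star_weight.
rewrite big_uniq ?uniq_neighbours //= big_mkcond [RHS]big_mkcond; apply: eq_bigr => u _ /=.
rewrite mem_neighbours !finset.in_set finset.in_set1 /spoke_weight.
have [->|uv] := eqVneq u v; first by rewrite adj_irrefl //= if_same.
by case: adj; case: (a _).
Qed.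

Lemma local_gainE c (a : nat -> bool) :
  local_gain c (view E w ID v) (inbox t v) a = gain wc c O v [set u in cl v | a (ID u)].
Proof. by rewrite /local_gain local_covE local_weightE. Qed.

Lemma local_starE c u :
  local_star c (view E w ID v) (inbox t v) (ID u) = (u \in star cl wc c O v).
Proof.
rewrite /local_star.
have -> : (ID u \in [seq m.1 | m <- inbox t v]) = (u \in cl v).
  by rewrite -map_comp (mem_map ID_inj) mem_closed_seq.
apply/andP/idP => [[uv /asboolP[a [ha au]]]|ust].
  have /fintype.subsetP : [set u in cl v | a (ID u)] \subset star cl wc c O v.
    apply: sub_star; apply/andP; split.
      by apply/fintype.subsetP => x; rewrite finset.in_set => /andP[].
    apply/forallP => B; apply/implyP => sB; have := ha (pred_set B).
    rewrite !local_gainE; congr (gain _ _ _ _ _ <= _).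
    apply/setP => x; rewrite finset.in_set pred_setE andbC.
    by case xB: (x \in B) => //=; rewrite (fintype.subsetP sB).
  by apply; rewrite finset.in_set uv.
split; first exact: (fintype.subsetP (star_cl _ _ _ _ _)) ust.
apply/asboolP; exists (pred_set (star cl wc c O v)); rewrite pred_setE; split=> // b.
rewrite !local_gainE.
have -> : [set x in cl v | pred_set (star cl wc c O v) (ID x)] = star cl wc c O v.
  apply/setP => x; rewrite finset.in_set pred_setE andbC.
  by case xB: (x \in star _ _ _ _ _) => //=; rewrite (fintype.subsetP (star_cl _ _ _ _ _) _ xB).
by apply: gain_star; apply/fintype.subsetP => x; rewrite finset.in_set => /andP[].
Qed.

Lemma local_cov_star (B : {set V}) (a : nat -> bool) : B \subset cl v ->
  (forall u, a (ID u) = (u \in B)) -> local_cov (inbox t v) a = #|cov O B|.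
Proof.
move=> sB ha; rewrite local_covE; congr #|pred_of_set (cov _ _)|.
apply/setP => x; rewrite finset.in_set ha andbC.
by case xB: (x \in B) => //=; rewrite (fintype.subsetP sB _ xB).
Qed.

Lemma local_thresholdE :
  local_threshold (view E w ID v) (inbox t v) = threshold cl wc O v.
Proof.
rewrite /local_threshold /threshold; congr classical_sets.xget; apply/funext => c.
suff d c' : local_attains c' (view E w ID v) (inbox t v) = attains cl wc c' O v.
  by rewrite !d.
rewrite /local_attains (local_cov_star (star_cl cl wc c' O v)) ?card_gt0 // => u.
exact: local_starE.
Qed.

End Star.

Definition node_base (O : {set V * V}) (D : {set V}) v (s : node R) : Prop :=
  [/\ node_id s = ID v, node_view s = view E w ID v, node_tape s = tape v,
      forall y, node_open s (ID y) = ((v, y) \in O)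
    & forall y, node_chosen s (ID y) = (y \in D)].

(** What a frozen vertex keeps showing its neighbours: threshold 0, no votes, nothing added. With
    nothing left to cover around it, this stays correct while the uncovered set shrinks. *)
Definition node_stopped (O : {set V * V}) v (s : node R) : Prop :=
  [/\ node_halted s, cov O (cl v) = finset.set0, node_threshold s = 0,
      forall i j, node_vote s i j = false & forall i, node_added s i = false].

Definition node_running ph it (s : node R) : Prop :=
  [/\ node_halted s = false, node_phase s = ph & node_iter s = it].

Lemma stoppedS (O O' : {set V * V}) v s : O' \subset O -> node_stopped O v s -> node_stopped O' v s.
Proof.
move=> sO [h1 h2 h3 h4 h5]; split=> //; apply/eqP; rewrite -finset.subset0 -h2.
exact: covS.
Qed.

Lemma stopped_row (O : {set V * V}) v s y : (forall p, p \in O -> adj E p.1 p.2) ->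
  node_stopped O v s -> ((v, y) \in O) = false.
Proof.
move=> adjO [_ e _ _ _]; apply/negP => vy; have := finset.in_set0 (v, y).
by rewrite -e !finset.in_set !finset.in_set1 vy eqxx (adjO _ vy) orbT.
Qed.


Local Notation rk := tape_rank.
Local Notation D k v := (chosen E w ID rk k v).
Local Notation thr O v := (threshold cl wc O v).

Definition node_state ph it (O : {set V * V}) (B : {set V}) v (s : node R) : Prop :=
  node_base O B v s /\ (node_running ph it s \/ node_stopped O v s).

(** The star is constrained only at positive thresholds, because the star kept by a frozen vertex
    may be outdated. *)
Definition node_starred (O : {set V * V}) v (s : node R) : Prop :=
  node_threshold s = thr O v /\
  (0 < thr O v -> forall y, node_star s (ID y) = (y \in best cl wc O v)).

Definition node_voted k v (s : node R) : Prop := forall y u,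
  node_vote s (ID y) (ID u) = votes_for cl wc ID (U k) (rk k) (v, y) u.

Definition added k v : {set V} :=
  if success cl wc ID (U k) (rk k) v then best cl wc (U k) v else finset.set0.

Lemma round_star t k : (forall v, node_state 0 k (U k) (D k v) v (S t v)) ->
  forall v, [/\ node_state 1 k (U k) (D k v) v (S t.+1 v), node_starred (U k) v (S t.+1 v)
    & node_halted (S t.+1 v) = (thr (U k) v == 0)].
Proof.
move=> h v; have [[h1 h2 h3 h4 h5] hv] := h v.
rewrite states_atS //; case: hv => [[-> hp hi]|st]; last first.
  have [-> c0 n0 _ _] := st.
  have t0 : thr (U k) v = 0 by apply: (threshold0 (spoke_weight_ge0 w_ge0) c0).
  split; first by split=> //; right.
    by split; rewrite ?n0 t0 // ltxx.
  by rewrite t0 eqxx; case: st.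
have hO x y : node_open (S t x) (ID y) = ((x, y) \in U k) by have [[]] := h x.
have hc := local_thresholdE v hO.
rewrite /local_update hp h2 hc; split=> //; last first.
  by split=> //= _ y; apply: local_starE.
split; first by split.
have [c0|c0] := eqVneq (thr (U k) v) 0; [right|left]; split=> //=; rewrite ?hc ?c0 ?eqxx //.
  apply/eqP; rewrite -[_ == _]negbK -(threshold_gt0 (spoke_weight_ge0 w_ge0) v) ?c0 ?ltxx //.
  exact: weighty_uncovered.
Qed.

Lemma mem_best_cl O x y : y \in best cl wc O x -> x \in cl y.
Proof.
by rewrite -closed_nbhd_sym; apply: (fintype.subsetP (best_sub _ _ _ _)).
Qed.

Lemma uncovered_adj k p : p \in U k -> adj E p.1 p.2.
Proof. by move=> pU; apply: uncovered0_adj (fintype.subsetP (uncovered_sub _ _ _ _ _) _ pU). Qed.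

(** Stars and ranks of other nodes matter only when their threshold equals the positive one of the
    candidate, and then they are current even if other neighbours are frozen. *)
Lemma round_vote t k :
  (forall v, node_state 1 k (U k) (D k v) v (S t v) /\ node_starred (U k) v (S t v)) ->
  forall v, [/\ node_state 2 k (U k) (D k v) v (S t.+1 v), node_starred (U k) v (S t.+1 v),
    node_voted k v (S t.+1 v) & node_halted (S t.+1 v) = node_halted (S t v)].
Proof.
move=> h v; have [[[h1 h2 h3 h4 h5] hv] hs] := h v.
rewrite states_atS //; case: hv => [[e hp hi]|st]; last first.
  have [nh _ _ nv _] := st; rewrite nh; split=> //; first by split=> //; right.
  move=> y u; rewrite nv /votes_for.
  by rewrite (stopped_row y (@uncovered_adj k) st).
have thrE x : node_threshold (S t x) = thr (U k) x by have [_ []] := h x.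
have starE x y : 0 < thr (U k) x -> node_star (S t x) (ID y) = (y \in best cl wc (U k) x).
  by move=> x0; have [_ [_ ->]] := h x.
have rankE x : 0 < thr (U k) x -> node_rank (S t x) = rk k x.
  move=> x0; have [[[_ _ tx _ _] [[_ _ ix]|[_ _ nx _ _]]] _] := h x.
    by rewrite /node_rank tx ix.
  by move: x0; rewrite -thrE nx ltxx.
rewrite e /local_update hp; split=> //.
  by split; [split | left; split].
move=> y u; rewrite -[LHS]/(local_vote (S t v) (inbox t v) (ID y) (ID u)).
rewrite /local_vote h1 h4 /votes_for; congr (_ && _).
rewrite has_inbox; apply/exists_inP/and4P => [[x xv /and5P[/eqP/ID_inj xu]]|[u0 vu yu ku]].
  subst x; rewrite all_inbox /= thrE => u0; rewrite !starE // => vu yu /forall_inP ku.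
  split=> //; apply/forall_inP => x' x'v.
  have /andP[/= le_x' /implyP kx] := ku x' x'v; rewrite !thrE /= in le_x' kx.
  rewrite le_x' /=; apply/implyP => /and3P[/eqP e' a b].
  have := kx; rewrite e' eqxx !starE ?e' // a b => /(_ isT).
  by rewrite /node_key_le !rankE ?e'.
exists u; first exact: mem_best_cl vu.
rewrite all_inbox /= eqxx thrE u0 !starE // vu yu; apply/forall_inP => x' x'v /=.
have /andP[] := forall_inP ku _ x'v.
rewrite !thrE => -> /implyP kx /=; apply/implyP => /and3P[/eqP e'].
rewrite !starE ?e' // => a b; have := kx; rewrite e' eqxx a b => /(_ isT).
by rewrite /node_key_le !rankE ?e'.
Qed.

Lemma added_sub k x : added k x \subset cl x.
Proof. by rewrite /added; case: ifP => _; [apply: best_sub|apply: finset.sub0set]. Qed.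

Lemma chosen_added k v : D k.+1 v = D k v :|: added k v :\ v.
Proof. by rewrite /added /=; case: ifP; rewrite // finset.set0D. Qed.

Lemma round_count t k :
  (forall v, [/\ node_state 2 k (U k) (D k v) v (S t v), node_starred (U k) v (S t v)
     & node_voted k v (S t v)]) ->
  forall v, [/\ node_state 3 k.+1 (U k) (D k.+1 v) v (S t.+1 v),
    forall y, node_added (S t.+1 v) (ID y) = (y \in added k v)
    & node_halted (S t.+1 v) = node_halted (S t v)].
Proof.
move=> h v; have [[[h1 h2 h3 h4 h5] hv] [ht hs] _] := h v.
rewrite states_atS //; case: hv => [[e hp hi]|st]; last first.
  have [nh _ n0 _ na] := st; rewrite nh.
  have a0 : added k v = finset.set0 by rewrite /added /success -ht n0 ltxx.
  split=> //; last by move=> y; rewrite na a0 finset.in_set0.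
  split; last by right.
  by split=> // y; rewrite chosen_added a0 finset.set0D finset.setU0.
have openE x y : node_open (S t x) (ID y) = ((x, y) \in U k) by have [[[]]] := h x.
have addE y : local_success (S t v) (inbox t v) && node_star (S t v) (ID y) = (y \in added k v).
  rewrite /local_success /added /success ht; case: (ltP 0 (thr (U k) v)) => v0 /=; last first.
    by rewrite finset.in_set0.
  rewrite (local_cov_star openE (best_sub _ _ _ _) (hs v0)) hs //.
  have -> : (\sum_(m <- inbox t v) \sum_(m' <- inbox t v) node_vote m.2 m'.1 (node_id (S t v)) =
             #|votes cl wc ID (U k) (rk k) v|)%N.
    rewrite /inbox big_map sum_closed_seq.
    under eq_bigr do rewrite big_map sum_closed_seq.
    rewrite pair_big_dep -sum1_card big_mkcond [RHS]big_mkcond.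
    apply: eq_bigr => -[x y'] _ /=; have [_ _ vx] := h x.
    rewrite h1 vx [_ \in votes _ _ _ _ _ _]finset.in_set.
    case: (boolP (votes_for _ _ _ _ _ _ _)) => [|_]; last by case: ifP.
    case/and5P=> _ _ /(fintype.subsetP (best_sub _ _ _ _)) ->.
    move=> /(fintype.subsetP (best_sub _ _ _ _)) ->.
    by [].
  by case: ifP => _; rewrite /= ?finset.in_set0.
rewrite e /local_update hp; split=> //=.
split; last by left; split=> //=; rewrite hi.
split=> //= y.
rewrite addE h5 h1 (inj_eq ID_inj) -[RHS]/(y \in D k.+1 v) chosen_added.
by rewrite finset.in_setU finset.in_setD1 [_ && (y != v)]andbC.
Qed.

(** Stated for arbitrary [O] and [Add] to serve both the removal of the pairs covered for free and
    the end of every iteration. *)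
Lemma round_open t k (O : {set V * V}) (B : V -> {set V}) (Add : V -> {set V}) :
  (forall x, Add x \subset cl x) -> (forall p, p \in O -> adj E p.1 p.2) ->
  (forall v, node_state 3 k O (B v) v (S t v) /\
     forall y, node_added (S t v) (ID y) = (y \in Add v)) ->
  forall v, node_state 0 k
    [set p in O | ~~ [exists x, (p.1 \in Add x) && (p.2 \in Add x)]] (B v) v (S t.+1 v) /\
    node_halted (S t.+1 v) = node_halted (S t v).
Proof.
move=> sA adjO h v; have [[[h1 h2 h3 h4 h5] hv] _] := h v.
set O' := finset _; have sO : O' \subset O.
  by apply/fintype.subsetP => p; rewrite finset.in_set => /andP[].
rewrite states_atS //; case: hv => [[e hp hi]|st]; last first.
  have [nh _ _ _ _] := st; rewrite nh; split=> //; split; last by right; apply: stoppedS st.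
  split=> // y; rewrite h4 finset.in_set.
  by rewrite (stopped_row y adjO st).
rewrite e /local_update hp; split=> //; split; last by left; split.
split=> // y; rewrite -[LHS]/(local_open (S t v) (inbox t v) (ID y)).
rewrite /local_open h4 finset.in_set h1; congr (_ && ~~ _).
rewrite has_inbox; apply/exists_inP/existsP => [[x _ /=]|[x /andP[vx yx]]].
  by have [_ ax] := h x; rewrite !ax; exists x.
exists x; last by have [_ ax] := h x; rewrite /= !ax vx.
by rewrite closed_nbhd_sym; apply: (fintype.subsetP (sA x)).
Qed.

Lemma round_init v :
  node_state 3 0 [set p | adj E p.1 p.2] (D 0 v) v (S 0 v) /\
  forall y, node_added (S 0 v) (ID y) = (y \in free_star E w v).
Proof.
have zE y : ((ID y, 0) \in view E w ID v) = adj E v y && (w [set v; y] == 0).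
  apply/mapP/andP => [[u uv [/ID_inj -> ->]]|[yv /eqP wy]].
    by rewrite eqxx -mem_neighbours.
  by exists y; rewrite ?mem_neighbours // wy.
have fE y : (ID y == ID v) || ((ID y, 0) \in view E w ID v) = (y \in free_star E w v).
  by rewrite zE (inj_eq ID_inj) finset.in_setU1 finset.in_set.
split=> //; split; last by left; split.
split=> //= y; last by rewrite fE (inj_eq ID_inj) finset.in_setD1 andbC.
rewrite finset.in_set /view -map_comp.
by rewrite (_ : map _ _ = map ID (neighbours E ID v)) // (mem_map ID_inj) mem_neighbours.
Qed.

(** One initial removal round, then four rounds per iteration. *)
Lemma sim_uncovered k : forall v, node_state 0 k (U k) (D k v) v (S (4 * k).+1 v).
Proof.
elim: k => [|k IH] v.
  have := round_open (@free_star_sub _ _ E w) _ round_init v.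
  have -> : [set p in [set p | adj E p.1 p.2] | ~~ [exists x, (p.1 \in free_star E w x) &&
     (p.2 \in free_star E w x)]] = U 0.
    by apply/setP => p; rewrite !finset.in_set.
  by case=> // p; rewrite finset.in_set.
have h1 := round_star IH.
have h2 := round_vote (fun x => let: And3 a b _ := h1 x in conj a b).
have h3 := round_count (fun x => let: And4 a b c _ := h2 x in And3 a b c).
have := round_open (@added_sub k) (@uncovered_adj k)
  (fun x => let: And3 a b _ := h3 x in conj a b) v.
rewrite mulnS addnC !addnS addn0 => -[+ _].
suff -> : [set p in U k | ~~ [exists x, (p.1 \in added k x) && (p.2 \in added k x)]] = U k.+1 by [].
apply/setP => p; rewrite !finset.in_set; congr (_ && ~~ _).
apply: eq_existsb => x; rewrite /added; case: ifP => //= _.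
by rewrite !finset.in_set0.
Qed.

Lemma sim_star k v : [/\ node_state 1 k (U k) (D k v) v (S (4 * k).+2 v),
  node_starred (U k) v (S (4 * k).+2 v)
  & node_halted (S (4 * k).+2 v) = (thr (U k) v == 0)].
Proof. exact: round_star (sim_uncovered k) v. Qed.

(** Halting is decided in the star round only, so the status is constant until the next one. *)
Lemma sim_halted k r v : (r < 4)%N ->
  node_halted (S ((4 * k).+2 + r) v) = (thr (U k) v == 0).
Proof.
have h1 := sim_star k.
have h2 := round_vote (fun x => let: And3 a b _ := h1 x in conj a b).
have h3 := round_count (fun x => let: And4 a b c _ := h2 x in And3 a b c).
have h4 := round_open (@added_sub k) (@uncovered_adj k)
  (fun x => let: And3 a b _ := h3 x in conj a b).
have [_ _ e1] := h1 v; have [_ _ _ e2] := h2 v; have [_ _ e3] := h3 v; have [_ e4] := h4 v.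
case: r => [|[|[|[|//]]]] _; rewrite ?addn0 ?addn1 ?addn2 ?addn3 //.
- by rewrite e2.
- by rewrite e3 e2.
by rewrite e4 e3 e2.
Qed.

Lemma threshold_uncovered_eq0 k : U k = finset.set0 <-> forall v, thr (U k) v = 0.
Proof.
split=> [e v|h].
  by apply: (threshold0 (spoke_weight_ge0 w_ge0)); rewrite e; apply/eqP;
    rewrite -finset.subset0 cov_sub.
apply/eqP/finset.set0Pn => -[p pU].
suff : 0 < thr (U k) p.1 by rewrite h ltxx.
rewrite (threshold_gt0 (spoke_weight_ge0 w_ge0)); last exact: weighty_uncovered.
by apply/finset.set0Pn; exists p; apply: cov_closed_nbhd.
Qed.

Lemma isSome_output s : isSome (output (l := A) s) = node_halted s.
Proof. by rewrite /=; case: ifP. Qed.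

Lemma terminatedP t : (2 <= t)%N ->
  terminated A E w ID tape t <-> U ((t - 2) %/ 4) = finset.set0.
Proof.
move=> t2; have et : t = ((4 * ((t - 2) %/ 4)).+2 + (t - 2) %% 4)%N by lia.
have r4 : ((t - 2) %% 4 < 4)%N by rewrite ltn_mod.
split=> [h|/threshold_uncovered_eq0 h v].
  apply/threshold_uncovered_eq0 => v; apply/eqP.
  by rewrite -(sim_halted _ _ r4) -et -isSome_output; apply: h.
by rewrite isSome_output et sim_halted // h.
Qed.

Lemma not_terminated t v : (t < 2)%N -> ~ terminated A E w ID tape t.
Proof.
move=> t2 /(_ v); rewrite isSome_output.
by case: t t2 => [|[|//]] _.
Qed.

Lemma output_graphE k : U k = finset.set0 ->
  output_graph A E w ID tape (4 * k).+2 = chosen_graph E w ID rk k.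
Proof.
move=> U0; rewrite /output_graph /chosen_graph; congr (_ @: pred_of_set _)%SET.
apply/setP => -[v u]; rewrite !finset.in_set /=.
have [[[_ hv _ _ hc] _] _ hh] := sim_star k v.
have {}hh : node_halted (S (4 * k).+2 v).
  by rewrite hh (threshold_uncovered_eq0 k).1.
rewrite [states_at]lock /= -lock hh /= mem_filter hc hv /view -map_comp.
rewrite (_ : map _ _ = map ID (neighbours E ID v)) // (mem_map ID_inj) mem_neighbours.
by apply/andP/idP => [[]|h] //; split=> //; apply: chosenP h.
Qed.

Lemma algorithm_correct : exists t,
  let H := output_graph A E w ID tape t in
  [/\ terminated A E w ID tape t, is_spanner 2 E H &
   forall H', is_spanner 2 E H' ->
     cost w H <= 64 * harmonic_sum R ((max_degree E).+1 ^ 2) * cost w H'].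
Proof.
have [k U0] := uncovered_eq0 ID w_ge0 tape_rank.
exists (4 * k).+2; rewrite (output_graphE U0); split.
- by rewrite terminatedP // !subSS subn0 mulKn.
- exact: chosen_graph_spanner.
by move=> H' sH'; apply: (cost_chosen_graph_le E_simple w_ge0 ID_inj tape_rank sH').
Qed.

End Simulation.

Local Open Scope classical_set_scope.
Local Open Scope ring_scope.

(** * Running time *)

Section RandomTapes.
Variables (R : realType) (d : measure_display) (T : measurableType d).
Variables (P : probability T R) (V : finType) (tape : T -> V -> nat -> bool).
Hypothesis fair : iid_fair_bits P (fun (i : V * nat) x => tape x i.1 i.2).
Variables (N m : nat).

Local Notation word := {ffun 'I_N.+1 -> bool}.
Local Notation sample := {ffun V -> word}.

Definition sample_at (tp : V -> nat -> bool) (k : nat) : sample :=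
  [ffun v => [ffun j : 'I_N.+1 => tp v (pickle (k, nat_of_ord j))]].

Definition sample_of (tp : V -> nat -> bool) : m.-tuple sample :=
  [tuple sample_at tp k | k < m].

Lemma measurable_bit (i : V * nat) (B : set bool) :
  measurable ((fun x => tape x i.1 i.2) @^-1` B).
Proof.
have [mX _ _] := fair; rewrite -[X in measurable X]setTI.
by apply: mX.
Qed.

Lemma prob_bit (i : V * nat) (b : bool) :
  P ((fun x => tape x i.1 i.2) @^-1` [set b]) = (2^-1)%:E.
Proof.
have [_ half _] := fair; case: b; first exact: half.
have -> : (fun x => tape x i.1 i.2) @^-1` [set false] =
  ~` ((fun x => tape x i.1 i.2) @^-1` [set true]).
  by apply/seteqP; split=> x /=; case: (tape x _ _).
rewrite probability_setC ?half //; last exact: measurable_bit.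
by rewrite -EFinB; congr EFin; lra.
Qed.

Definition bit_indices : seq (V * nat) :=
  [seq (q.1.1, pickle (nat_of_ord q.1.2, nat_of_ord q.2)) | q : V * 'I_m * 'I_N.+1].

(** A condition on a single bit, so that fixing a sample is an intersection over distinct indices,
    to which independence applies. *)
Definition bit_value (s : m.-tuple sample) (i : V * nat) : set bool :=
  [set b | forall (k : 'I_m) (j : 'I_N.+1),
     i.2 = pickle (nat_of_ord k, nat_of_ord j) -> b = tnth s k i.1 j].

Lemma bit_valueE s (v : V) (k : 'I_m) (j : 'I_N.+1) :
  bit_value s (v, pickle (nat_of_ord k, nat_of_ord j)) = [set tnth s k v j].
Proof.
apply/seteqP; split=> b /=; first by move/(_ k j); apply.
move=> -> k' j' /(pcan_inj pickleK) [/val_inj -> /val_inj ->] //.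
Qed.

Lemma sample_event s : [set x | sample_of (tape x) = s] =
  \bigcap_(i in [set` bit_indices]) ((fun x => tape x i.1 i.2) @^-1` bit_value s i).
Proof.
apply/seteqP; split=> x /=.
  move=> <- _ /mapP[[[v k] j] _ ->] /=.
  by rewrite bit_valueE /= tnth_mktuple !ffunE.
move=> h; apply: eq_from_tnth => k; rewrite tnth_mktuple.
apply/ffunP => v; rewrite ffunE; apply/ffunP => j; rewrite ffunE.
have := h (v, pickle (nat_of_ord k, nat_of_ord j)); rewrite /= bit_valueE; apply.
by apply/mapP; exists (v, k, j); rewrite ?mem_enum.
Qed.

Lemma uniq_bit_indices : uniq bit_indices.
Proof.
rewrite map_inj_uniq ?enum_uniq // => -[[v k] j] [[v' k'] j'] /= [-> ] e.
by have [/val_inj -> /val_inj ->] := pcan_inj pickleK e.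
Qed.

Lemma card_samples : (#|{: sample}| ^ m = 2 ^ size bit_indices)%N.
Proof.
rewrite size_map -cardE !card_prod !card_ffun card_bool !card_ord.
by rewrite -!expnM; congr (_ ^ _)%N; ring.
Qed.

Lemma measurable_sample s : measurable [set x | sample_of (tape x) = s].
Proof.
rewrite sample_event; apply: fin_bigcap_measurable; first exact: finite_seq.
by move=> i _; apply: measurable_bit.
Qed.

Lemma prob_sample s : P [set x | sample_of (tape x) = s] = ((#|{: sample}| ^ m)%:R^-1)%:E.
Proof.
have [_ _ indep] := fair; rewrite sample_event indep ?uniq_bit_indices //.
rewrite (eq_big_seq (fun=> (2^-1 : R)%:E)) => [|_ /mapP[[[v k] j] _ ->]].
  rewrite card_samples prodEFin; congr EFin.
  rewrite big_const_seq count_predT natrX -exprVn.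
  by elim: (size _) => //= n ->; rewrite exprS.
by rewrite bit_valueE prob_bit.
Qed.

(** A finite disjoint union of equally likely samples; this converts the counting bounds into
    probabilities. *)
Lemma prob_samples (G : pred (m.-tuple sample)) :
  measurable [set x | G (sample_of (tape x))] /\
  P [set x | G (sample_of (tape x))] = (#|[set s | G s]%SET|%:R / (#|{: sample}| ^ m)%:R)%:E.
Proof.
pose r := enum [set s | G s]%SET.
have -> : [set x | G (sample_of (tape x))] =
  \bigcup_(s in [set` r]) [set x | sample_of (tape x) = s].
  apply/seteqP; split=> x /=; last by case=> s /=; rewrite mem_enum finset.in_set => Gs ->.
  by move=> Gx; exists (sample_of (tape x)); rewrite //= mem_enum finset.in_set.
split; first by apply: fin_bigcup_measurable => // s _; apply: measurable_sample.
rewrite measure_fin_bigcup //; first last.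
- by move=> s _; apply: measurable_sample.
- by move=> s s' _ _ [x [/= -> ->]].
rewrite -fsbig_seq ?enum_uniq // (eq_bigr (fun=> ((#|{: sample}| ^ m)%:R^-1 : R)%:E)) => [|s _].
  by rewrite sumEFin big_const_seq count_predT iter_addr_0 -cardE mulr_natl.
exact: prob_sample.
Qed.

End RandomTapes.

Section RunUncovered.
Variables (R : realType) (V : finType) (E : {set {set V}}) (w : {set V} -> R).
Variables (ID : V -> nat) (tp : V -> nat -> bool) (N : nat).

Lemma tape_rank_sample k v : (k <= N.+1)%N ->
  tape_rank tp k v = word_key k (sample_at N tp k v).
Proof.
move=> kN; rewrite /tape_rank /word_key /rank_code; congr pickle.
apply/eq_in_map => j; rewrite mem_iota /= add0n => jk.
by rewrite !ffunE inordK // (leq_trans jk).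
Qed.

Lemma eq_step (cl : V -> {set V}) (wc : V -> V -> R) U rk rk' :
  rk =1 rk' -> step cl wc ID U rk = step cl wc ID U rk'.
Proof. by move=> /funext ->. Qed.

Lemma run_uncovered_iota k m : (k + m <= N.+1)%N ->
  run (closed_nbhd E) (spoke_weight w) ID k (uncovered E w ID (tape_rank tp) k)
    [seq sample_at N tp j | j <- iota k m] = uncovered E w ID (tape_rank tp) (k + m).
Proof.
elim: m k => [|m IH] k kN /=; first by rewrite addn0.
rewrite addnS -addSn -IH; last by rewrite addSnnS.
congr (run _ _ _ _ _ _); apply: eq_step => v; rewrite tape_rank_sample //.
by rewrite (leq_trans _ kN) // leq_addr.
Qed.

Lemma run_uncovered m : (m <= N.+1)%N ->
  run (closed_nbhd E) (spoke_weight w) ID 0 (uncovered0 E w)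
    (sample_of N m tp) = uncovered E w ID (tape_rank tp) m.
Proof.
move=> mN; rewrite -[RHS](@run_uncovered_iota 0 m) //=; congr run.
by rewrite -val_enum_ord -map_comp.
Qed.

End RunUncovered.

(** * Numerical estimates *)

Section Estimates.
Variable R : realType.
Implicit Types (x : R) (k n L m : nat).

Lemma pow2_bracket x : 0 < x -> exists i : int, 2 ^ i <= x < 2 ^ (i + 1).
Proof.
move=> x0; pose m0 := Num.bound x^-1.
pose f m : bool := x < 2 ^ (m%:Z - m0%:Z).
have [m fm minf] : exists2 m, f m & forall l, f l -> (m <= l)%N.
  have exf : exists m, f m.
    exists (m0 + Num.bound x)%N; rewrite /f PoszD addrAC subrr add0r.
    by apply: lt_le_trans (leq_exp2 R _); apply: archi_boundP; apply: ltW.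
  by case: (ex_minnP exf) => m fm minf; exists m.
case: m fm minf => [|m] fm minf.
  have : x^-1 < m0%:R by apply: archi_boundP; rewrite invr_ge0 ltW.
  move/lt_le_trans/(_ (leq_exp2 R m0)); move: fm; rewrite /f sub0r -exprnN.
  rewrite -[X in X < _]invrK ltf_pV2 ?posrE ?invr_gt0 ?exprn_gt0 //.
  by move=> /lt_trans h/h; rewrite ltxx.
exists (m%:Z - m0%:Z); apply/andP; split.
  by rewrite leNgt; apply/negP => /minf; rewrite ltnn.
by move: fm; rewrite /f -[m.+1]addn1 PoszD addrAC.
Qed.

Lemma le_log_ge1 x : ln x <= log_ge1 x.
Proof. by rewrite /log_ge1 le_max lexx orbT. Qed.

Lemma log_ge1_ge1 x : 1 <= log_ge1 x.
Proof. by rewrite /log_ge1 le_max lexx. Qed.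

Lemma ln8_le3 : ln 8 <= 3 :> R.
Proof.
have -> : 8 = 2 ^+ 3 :> R by rewrite -natrX.
rewrite lnXn // -[leRHS](expRK (3 : R)) -lnXn // ler_ln ?posrE ?expR_gt0 ?exprn_gt0 //.
rewrite -[3 in leRHS](mulr1 (3 : R)) -[3 in leRHS]/(3%:R) expRM_natl lerXn2r ?nnegrE ?expR_ge0 //.
by apply: le_trans (expR_ge1Dx _); lra.
Qed.

(** Because [expR (1 / 2) <= 2]. *)
Lemma le_pow2 x k : 0 < x -> 2 * ln x <= k%:R -> x <= 2 ^+ k.
Proof.
move=> x0 h; have half : expR (2^-1 : R) <= 2.
  have := expR_ge1Dx (- 2^-1 : R); rewrite expRN => h1.
  rewrite -lef_pV2 ?posrE ?expR_gt0 //; apply: le_trans h1; lra.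
apply: (@le_trans _ _ (expR (k%:R * 2^-1))).
  by rewrite -[leLHS](lnK x0) ler_expR; lra.
by rewrite expRM_natl lerXn2r ?nnegrE ?expR_ge0.
Qed.

Lemma harmonic_le_ln n : (0 < n)%N -> harmonic_sum R n <= 1 + ln n%:R.
Proof.
case: n => // n _; elim: n => [|n IH].
  by rewrite /harmonic_sum big_ord_recl big_ord0 /= ln1; lra.
have -> : harmonic_sum R n.+2 = harmonic_sum R n.+1 + n.+2%:R^-1.
  by rewrite /harmonic_sum big_ord_recr.
suff : (n.+2%:R : R)^-1 <= ln n.+2%:R - ln n.+1%:R.
  by move: IH; move: (ln _) (ln _) (_^-1) (harmonic_sum _ _) => *; lra.
have n1 : 0 < n.+1%:R :> R by rewrite ltr0n.
have n2 : 0 < n.+2%:R :> R by rewrite ltr0n.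
have := @le_ln1Dx R (- n.+2%:R^-1).
have -> : 1 + - n.+2%:R^-1 = n.+1%:R / n.+2%:R :> R.
  apply: (mulIf (lt0r_neq0 n2)); rewrite mulrDl mulNr.
  rewrite mulVf ?mulfVK ?lt0r_neq0 // -[n.+2]addn1 natrD; lra.
rewrite ln_div ?posrE // => h.
suff : -1 < - (n.+2%:R : R)^-1.
  by move/h; move: (ln _) (ln _) (_^-1) => *; lra.
by rewrite ltrN2 invf_lt1 // ltr1n.
Qed.

(** For positive [k], [1 + 2 * ln (k + 1) <= 3 + 2 * ln k], which is at most five times the
    truncated logarithm. *)
Lemma harmonic_degree k : harmonic_sum R (k.+1 ^ 2) <= 5 * log_ge1 k%:R.
Proof.
apply: le_trans (harmonic_le_ln _) _; first by rewrite expn_gt0.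
rewrite natrX lnXn ?ltr0n //; have l1 := @log_ge1_ge1 k%:R.
case: k l1 => [|k] l1; first by rewrite ln1 mul0rn; lra.
have lk := @le_log_ge1 k.+1%:R.
have : ln (k.+2%:R : R) <= 1 + ln k.+1%:R.
  have : ln (k.+2%:R : R) <= ln (2 * k.+1%:R).
    by rewrite ler_ln ?posrE ?mulr_gt0 ?ltr0n // -natrM ler_nat; lia.
  rewrite lnM ?posrE ?ltr0n // => h; apply: (le_trans h); rewrite lerD2r.
  by have := @le_ln1Dx R 1; lra.
rewrite mulr2n; lra.
Qed.

Lemma decay_le_expR m : (31 / 32) ^+ m <= expR (m%:R * (- 32^-1)) :> R.
Proof.
rewrite expRM_natl; apply: lerXn2r; rewrite ?nnegrE ?expR_ge0 //.
by apply: le_trans (expR_ge1Dx _); lra.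
Qed.

(** By [le_pow2] the exponent [2 * (ln 8 + 2 * ln n) <= 6 + 4 * a <= 10 * a] is enough, and rounding
    it up costs at most another [a]. *)
Lemma warmup_exists n : (2 <= n)%N ->
  exists k0, (8 * n ^ 2 <= 2 ^ k0)%N /\ k0%:R <= 11 * log_ge1 (n%:R : R).
Proof.
move=> n2; set a := log_ge1 _.
have a1 : 1 <= a := log_ge1_ge1 _; have la : ln n%:R <= a := @le_log_ge1 n%:R.
have a0 : 0 <= 10 * a by lra.
exists (Num.trunc (10 * a)).+1; split; last first.
  have := truncn_ge_nat (Num.trunc (10 * a)) a0; rewrite leqnn => /esym h.
  by rewrite -addn1 natrD; lra.
have n0 : 0 < n%:R :> R by rewrite ltr0n; lia.
rewrite -(ler_nat R) natrM !natrX; apply: le_pow2; first by rewrite mulr_gt0 ?exprn_gt0.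
rewrite lnM ?posrE ?exprn_gt0 // lnXn // mulr2n.
have := truncn_lt_nat (Num.trunc (10 * a)).+1 a0; rewrite ltnSn => /esym.
by have := ln8_le3; lra.
Qed.

(** The bounds [D + 1 <= 2 * D] and [W <= W ^ 2] reduce the claim to [8 * (D * W) ^ 2], with the
    constants of [warmup_exists]. *)
Lemma level_count_exists D (W : R) : (1 <= D)%N -> 1 <= W ->
  exists L, 2 * D.+1%:R ^+ 2 * W <= 2 ^+ L /\ L%:R <= 11 * log_ge1 (D%:R * W).
Proof.
move=> D1 W1; set b := log_ge1 _.
have b1 : 1 <= b := log_ge1_ge1 _; have lb : ln (D%:R * W) <= b := le_log_ge1 _.
have b0 : 0 <= 10 * b by lra.
have D0 : 1 <= D%:R :> R by rewrite ler1n.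
exists (Num.trunc (10 * b)).+1; split; last first.
  have := truncn_ge_nat (Num.trunc (10 * b)) b0; rewrite leqnn => /esym h.
  by rewrite -addn1 natrD; lra.
have DW0 : 0 < D%:R * W by rewrite mulr_gt0 ?(lt_le_trans ltr01).
apply: (@le_trans _ _ (8 * (D%:R * W) ^+ 2)).
  have : D.+1%:R <= 2 * D%:R :> R by rewrite -natrM ler_nat; lia.
  have d0 : 0 <= D.+1%:R :> R by [].
  move=> h; have : D.+1%:R ^+ 2 <= (2 * D%:R) ^+ 2 :> R by rewrite lerXn2r ?nnegrE.
  rewrite exprMn => h2.
  have hW : W <= W ^+ 2 by rewrite expr2 ler_peMr // (le_trans ler01).
  apply: (@le_trans _ _ (2 * (2 ^+ 2 * D%:R ^+ 2) * W)).
    by rewrite ler_wpM2r ?ler_pM2l // (le_trans ler01).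
  rewrite (_ : 2 * (2 ^+ 2 * D%:R ^+ 2) * W = 8 * D%:R ^+ 2 * W); last by ring.
  rewrite (_ : 8 * (D%:R * W) ^+ 2 = 8 * D%:R ^+ 2 * W ^+ 2); last by ring.
  by apply: ler_wpM2l; rewrite // mulr_ge0 // sqr_ge0.
apply: le_pow2; first by rewrite mulr_gt0 ?exprn_gt0.
rewrite lnM ?posrE ?exprn_gt0 // lnXn // mulr2n.
have := truncn_lt_nat (Num.trunc (10 * b)).+1 b0; rewrite ltnSn => /esym.
by have := ln8_le3; lra.
Qed.

(** With [a] the truncated logarithm of [n], the initial potential is at most
    [n ^ (4 * L) <= expR (44 * a * b)]. As [1451 = 11 + 32 * 45], the iterations after the warm-up
    contribute at most [expR (- 45 * a * b)], and [expR (- a * b) <= 1 / n]. *)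
Lemma failure_bound n k0 L K (b : R) : (2 <= n)%N -> 1 <= b ->
  k0%:R <= 11 * log_ge1 (n%:R : R) -> L%:R <= 11 * b ->
  1451 * log_ge1 (n%:R : R) * b <= K%:R ->
  exists m, K = (k0 + m)%N /\
    (31 / 32) ^+ m * ((n ^ 3).+1 ^ L)%:R <= n%:R^-1 :> R.
Proof.
set a := log_ge1 _ => n2 b1 hk hL hK; have a1 : 1 <= a := log_ge1_ge1 _.
have la : ln n%:R <= a := @le_log_ge1 n%:R.
have ab : a <= a * b by rewrite ler_peMr //; lra.
have k0K : (k0 <= K)%N by rewrite -(ler_nat R); lra.
exists (K - k0)%N; split; first by rewrite subnKC.
have mK : (K - k0)%:R = K%:R - k0%:R :> R by rewrite natrB.
move: mK; set m := (K - k0)%N => mK.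
have n1 : (0 < n)%N := ltnW n2.
have n0 : 0 < n%:R :> R by rewrite ltr0n.
have ln0 : 0 <= ln n%:R :> R by rewrite ln_ge0 // ler1n.
have h1 := decay_le_expR m.
have h2 : ((n ^ 3).+1 ^ L)%:R <= expR ((4 * L)%:R * ln n%:R) :> R.
  rewrite expRM_natl lnK ?posrE // exprM -natrX natrX lerXn2r ?nnegrE ?ler0n //.
  rewrite ler_nat (expnS n 3) (leq_trans _ (leq_mul n2 (leqnn _))) //.
  by rewrite mul2n -addnn -addn1 leq_add2l expn_gt0 n1.
apply: (@le_trans _ _ (expR (m%:R * (- 32^-1)) * expR ((4 * L)%:R * ln n%:R))).
  by apply: ler_pM => //; apply: exprn_ge0; rewrite divr_ge0.
rewrite -expRD -[in leRHS](lnK n0) -expRN ler_expR natrM.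
have : L%:R * ln n%:R <= (11 * b) * a by apply: ler_pM.
move: mK hK hk ab la; clear; move: K%:R k0%:R m%:R L%:R (ln n%:R) a => K' k' m' L' l a'.
by move=> *; lra.
Qed.

(** The difference [1500 - 1451] absorbs the loss in converting a bound on rounds into a whole
    number of iterations. *)
Lemma rounding_slack x (y : R) : 1 <= x -> 4 * (1500 * x) < 4 * y + 6 -> 1451 * x <= y.
Proof.
move=> x1; have : 49 <= 49 * x by apply: ler_peMr x1; apply: ler0n.
have -> : 1500 * x = 1451 * x + 49 * x by rewrite -mulrDl -natrD.
by move: (1451 * x) (49 * x) => *; lra.
Qed.

End Estimates.

(** * The range of density levels *)

Section LevelBounds.
Variables (R : realType) (V : finType) (E : {set {set V}}) (w : {set V} -> R).
Hypothesis E_simple : simple_graph E.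
Hypothesis w_ge0 : forall e, e \in E -> 0 <= w e.
Variable p0 : V * V.
Hypothesis p0_uncovered : p0 \in uncovered0 E w.

Local Notation U0 := (uncovered0 E w).
Local Notation cl := (closed_nbhd E).
Local Notation wc := (spoke_weight w).
Local Notation Mw := (max_weight E w).
Local Notation mw := (min_pos_weight E w).

Lemma uncovered0_weight p : p \in U0 -> 0 < w [set p.1; p.2]%SET.
Proof.
rewrite finset.in_set => /andP[ap /existsPn h]; rewrite lt_neqAle w_ge0 ?andbT //.
apply: contra (h p.1); rewrite eq_sym => e.
by rewrite !finset.in_setU1 eqxx !finset.in_set ap e orbT.
Qed.

Lemma le_max_weight e : e \in E -> w e <= Mw.
Proof. by move=> eE; apply: (le_bigmax_cond 0 w eE). Qed.

Lemma max_weight_gt0 : 0 < Mw.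
Proof.
apply: lt_le_trans (uncovered0_weight p0_uncovered) (le_max_weight _).
exact: (uncovered0_adj p0_uncovered).
Qed.

Lemma min_pos_weight_gt0 : 0 < mw.
Proof. by apply: lt_bigmin => [|e /andP[]//]; exact: max_weight_gt0. Qed.

Lemma min_pos_weight_le e : e \in E -> 0 < w e -> mw <= w e.
Proof. by move=> eE we; apply: (bigmin_le_cond Mw w); rewrite eE. Qed.

Lemma weight_ratio_ge1 : 1 <= weight_ratio E w.
Proof.
rewrite ler_pdivlMr ?min_pos_weight_gt0 // mul1r; have e0 := uncovered0_adj p0_uncovered.
apply: le_trans (min_pos_weight_le e0 (uncovered0_weight p0_uncovered)) (le_max_weight e0).
Qed.

Lemma max_degree_ge1 : (1 <= max_degree E)%N.
Proof.
apply: leq_trans (leq_bigmax p0.1); apply/card_gt0P; exists p0.2.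
by rewrite finset.in_set (uncovered0_adj p0_uncovered).
Qed.

Lemma card_vertices_ge2 : (2 <= #|V|)%N.
Proof.
rewrite -(E_simple (uncovered0_adj p0_uncovered)); exact: max_card.
Qed.

(** The star with the single spoke from [p.1] to [p.2] covers [p] and weighs at most [Mw]. *)
Lemma attains_lower_bound (i : int) (U : {set V * V}) :
  2 ^ i * Mw <= 1 -> U \subset U0 -> U != finset.set0 ->
  exists v, attains cl wc (2 ^ i) U v.
Proof.
move=> hi sU /finset.set0Pn[p pU]; exists p.1; have pU0 := fintype.subsetP sU _ pU.
have ap := uncovered0_adj pU0.
apply/(attainsP (spoke_weight_ge0 w_ge0)); first by apply: exprz_ge0.
exists [set p.1; p.2]%SET; split.
- by apply/fintype.subsetP => x; rewrite finset.in_set2 => /orP[]/eqP->;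
    rewrite ?closed_nbhd_refl // finset.in_setU1 finset.in_set ap orbT.
- by apply/finset.set0Pn; exists p; rewrite finset.in_set pU !finset.in_set2 !eqxx orbT.
apply: (@le_trans _ _ 1); last first.
  rewrite ler1n; apply/card_gt0P; exists p.
  by rewrite finset.in_set pU !finset.in_set2 !eqxx orbT.
apply: le_trans hi; apply: ler_wpM2l; first exact: exprz_ge0.
have p12 : p.1 != p.2 by apply/negP => /eqP e; move: ap; rewrite e adj_irrefl.
rewrite /star_weight big_setU1 ?finset.in_set1 //= big_set1 /spoke_weight eqxx add0r.
by rewrite eq_sym (negPf p12); apply: le_max_weight.
Qed.

(** A covering star has a spoke of positive weight, so it weighs at least [mw], and it covers at
    most [#|cl v| ^ 2] pairs. *)
Lemma attains_upper_bound v c : 0 <= c -> attains cl wc c U0 v ->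
  c * mw <= (max_degree E).+1%:R ^+ 2.
Proof.
move=> c0 /(attainsP (spoke_weight_ge0 w_ge0) _ _ c0) [B [sB dB hB]].
have wB : mw <= star_weight wc v B.
  have := weighty_uncovered0 w_ge0 sB dB.
  have wc0 u : u \in B -> 0 <= wc v u by move=> /(fintype.subsetP sB); exact: spoke_weight_ge0.
  rewrite lt_neqAle eq_sym => /andP[n0 _].
  have [u uB wu] : exists2 u, u \in B & wc v u != 0.
    apply/exists_inP; apply: contra_neqT n0 => /exists_inPn h.
    by apply: big1 => u /h /negPn/eqP.
  rewrite /star_weight (bigD1 u) //=; apply: (@le_trans _ _ (wc v u)).
    have := fintype.subsetP sB _ uB; rewrite finset.in_setU1 finset.in_set.
    move: wu (wc0 _ uB); rewrite /spoke_weight.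
    case: (eqVneq u v) => [_|uv]; first by rewrite /= eqxx.
    by move=> wu w0 /= vu; apply: min_pos_weight_le; rewrite // lt_neqAle eq_sym wu.
  by rewrite lerDl; apply: sumr_ge0 => x /andP[xB _]; apply: wc0.
apply: (@le_trans _ _ (c * star_weight wc v B)); first exact: ler_wpM2l.
apply: (le_trans hB); rewrite -natrX ler_nat -mulnn.
apply: (@leq_trans (#|cl v| * #|cl v|)); last by rewrite leq_mul ?card_closed_nbhd.
rewrite -cardsX; apply: subset_leq_card; apply/fintype.subsetP => -[x y].
rewrite finset.in_setX finset.in_set.
by move=> /and3P[_ /(fintype.subsetP sB) -> /(fintype.subsetP sB) ->].
Qed.

Lemma level_bounds L : 2 * (max_degree E).+1%:R ^+ 2 * weight_ratio E w <= 2 ^+ L ->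
  exists i : int,
    (forall U : {set V * V}, U \subset U0 -> U != finset.set0 ->
       exists v, attains cl wc (2 ^ i) U v) /\
    (forall v c, 0 <= c -> attains cl wc c U0 v -> c < 2 ^ (i + L%:Z)).
Proof.
move=> hL; have M0 := max_weight_gt0; have m0 := min_pos_weight_gt0.
have Mi : 0 < Mw^-1 by rewrite invr_gt0.
(* The lowest level is [1 / Mw] rounded down to a power of 2; the factor 2 in [hL] pays for the
   rounding. *)
have [i /andP[i1 i2]] := pow2_bracket Mi.
exists i; split=> [U|v c c0 /(attains_upper_bound c0) h].
  by apply: attains_lower_bound; rewrite -ler_pdivlMr // div1r.
rewrite -(ltr_pM2r m0); apply: (le_lt_trans h).
have D0 : 0 < (max_degree E).+1%:R ^+ 2 :> R by rewrite exprn_gt0.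
have e2 : 2 ^ (i + 1) = 2 * 2 ^ i :> R by rewrite expfzDr // expr1z mulrC.
have pi : 0 < 2 ^ i :> R by apply: exprz_gt0.
rewrite expfzDr //= -/(2 ^+ L).
have : 2 * (max_degree E).+1%:R ^+ 2 * Mw <= 2 ^+ L * mw.
  by move: hL; rewrite /weight_ratio mulrA ler_pdivrMr.
have h1 : 1 < 2 * 2 ^ i * Mw.
  by move: i2; rewrite e2 -div1r ltr_pdivrMr.
move=> h2; apply: (@lt_le_trans _ _ (2 ^ i * (2 * (max_degree E).+1%:R ^+ 2 * Mw))).
  rewrite (_ : 2 ^ i * _ = 2 * 2 ^ i * Mw * (max_degree E).+1%:R ^+ 2); last by ring.
  by rewrite ltr_pMl.
by rewrite -[leRHS]mulrA ler_pM2l.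
Qed.

End LevelBounds.

(** * Termination in time with high probability *)

Section FastTermination.
Variables (R : realType) (V : finType) (E : {set {set V}}) (w : {set V} -> R).
Variable ID : V -> nat.
Hypothesis E_simple : simple_graph E.
Hypothesis w_ge0 : forall e, e \in E -> 0 <= w e.
Hypothesis ID_inj : injective ID.

(** Emptiness of the uncovered set persists, so terminating by time [r] is a condition on one fixed
    iteration, hence on finitely many random bits. *)
Lemma terminated_byP (tp : V -> nat -> bool) (r : R) (v : V) : 2 <= r ->
  (exists2 t : nat, t%:R <= r & terminated (spanner_algorithm R) E w ID tp t) <->
  uncovered E w ID (tape_rank tp) ((Num.trunc r - 2) %/ 4) = finset.set0.
Proof.
move=> r2; have r0 : 0 <= r by apply: le_trans r2.
have tr2 : (2 <= Num.trunc r)%N by rewrite truncn_ge_nat.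
split=> [[t tr ht]|h].
  have [t2|t2] := ltnP t 2; first by case: (not_terminated v t2 ht).
  have /(terminatedP tp E_simple w_ge0 ID_inj t2) h := ht.
  apply: (uncovered_stop h); apply: leq_div2r; apply: leq_sub2r.
  by rewrite truncn_ge_nat.
exists (Num.trunc r); first by rewrite -truncn_ge_nat.
exact/(terminatedP tp E_simple w_ge0 ID_inj tr2).
Qed.

Lemma card_late_samples (K : nat) p0 : p0 \in uncovered0 E w ->
  1451 * log_ge1 (#|V|%:R : R) * log_ge1 ((max_degree E)%:R * weight_ratio E w) <= K%:R ->
  #|[set s : K.-tuple {ffun V -> {ffun 'I_K.+1 -> bool}} |
     run (closed_nbhd E) (spoke_weight w) ID 0 (uncovered0 E w) s != finset.set0]%SET|%:R /
    (#|{: {ffun V -> {ffun 'I_K.+1 -> bool}}}| ^ K)%:R <= (#|V|%:R : R)^-1.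
Proof.
move=> p0U hK; have n2 := card_vertices_ge2 E_simple p0U.
have D1 := max_degree_ge1 p0U; have W1 := weight_ratio_ge1 w_ge0 p0U.
have [k0 [k0_ge k0_le]] := warmup_exists R n2.
have [L [L_ge L_le]] := level_count_exists (D := max_degree E) D1 W1.
have [m [eK hm]] := failure_bound n2 (log_ge1_ge1 _) k0_le L_le hK.
have [i [lb ub]] := level_bounds E_simple w_ge0 p0U L_ge.
move: hK; subst K => _; set X := #|{: {ffun V -> {ffun 'I_(k0 + m).+1 -> bool}}}|.
have := card_run_late (spoke_weight_ge0 w_ge0) ID
  (weighty_uncovered0 w_ge0) lb ub k0_ge (leqnSn (k0 + m)).
set bad := #|_|; rewrite -/X -(ler_nat R) !natrM => h.
apply: le_trans hm.
have X0 : 0 < (X ^ (k0 + m))%:R :> R.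
  by rewrite ltr0n expn_gt0; apply/orP; left; apply/card_gt0P; exists [ffun=> [ffun=> false]].
have c0 : 0 < 32 ^+ m :> R by rewrite exprn_gt0.
rewrite ler_pdivrMr // -(ler_pM2l c0); move: h; rewrite !(natrX _ _ m) => /le_trans; apply.
rewrite expr_div_n [leRHS]mulrA [32 ^+ m * (_ * _)]mulrA [32 ^+ m * _]mulrC.
by rewrite divfK ?lt0r_neq0 // -mulrA [X in _ * X <= _]mulrC.
Qed.

Lemma fast_probability (d : measure_display) (T : measurableType d) (P : probability T R)
    (tape : T -> V -> nat -> bool) :
  iid_fair_bits P (fun (i : V * nat) x => tape x i.1 i.2) ->
  let fast := [set x | exists2 t : nat,
    t%:R <= 4 * 1500 * log_ge1 (#|V|)%:R * log_ge1 ((max_degree E)%:R * weight_ratio E w)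
    & terminated (spanner_algorithm R) E w ID (tape x) t] in
  measurable fast /\ ((1 - (#|V|%:R)^-1)%:E <= P fast)%E.
Proof.
move=> fair; set r := 4 * 1500 * _ * _ => fast.
have a1 := @log_ge1_ge1 R #|V|%:R.
have b1 := @log_ge1_ge1 R ((max_degree E)%:R * weight_ratio E w).
have ab : 1 <= log_ge1 (#|V|%:R : R) * log_ge1 ((max_degree E)%:R * weight_ratio E w).
  by rewrite mulr_ege1.
have r2 : 2 <= r.
  rewrite /r -mulrA; apply: (@le_trans _ _ (4 * 1500)); first by rewrite -natrM ler_nat.
  by apply: ler_peMr ab; rewrite -natrM ler0n.
(* Without vertices, round 0 is already terminated. *)
have [v _|V0] := pickP (fun v : V => true); last first.
  have -> : fast = setT.
    apply/seteqP; split=> // x _; exists 0%N; first by rewrite (le_trans _ r2).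
    by move=> v; have := V0 v.
  split; first exact: measurableT.
  by rewrite probability_setT lee_fin gerBl invr_ge0.
pose K := ((Num.trunc r - 2) %/ 4)%N.
have efast : fast = [set x | uncovered E w ID (tape_rank (tape x)) K = finset.set0].
  by apply/seteqP; split=> x /(terminated_byP (tape x) v r2).
pose G (s : K.-tuple {ffun V -> {ffun 'I_K.+1 -> bool}}) :=
  run (closed_nbhd E) (spoke_weight w) ID 0 (uncovered0 E w) s == finset.set0.
have {}efast : fast = [set x | G (sample_of K K (tape x))].
  rewrite efast; apply/seteqP; split=> x /=; rewrite /G run_uncovered //; [move=> ->|by move/eqP].
  exact: eqxx.
rewrite efast; have [mG ->] := prob_samples fair G; split; first exact: mG.
set X := #|{: {ffun V -> {ffun 'I_K.+1 -> bool}}}|.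
have X0 : 0 < (X ^ K)%:R :> R.
  by rewrite ltr0n expn_gt0; apply/orP; left; apply/card_gt0P; exists [ffun=> [ffun=> false]].
pose bad := [set s : K.-tuple {ffun V -> {ffun 'I_K.+1 -> bool}} |
  run (closed_nbhd E) (spoke_weight w) ID 0 (uncovered0 E w) s != finset.set0]%SET.
have eG : (#|[set s | G s]%SET| + #|bad| = X ^ K)%N.
  rewrite -card_tuple -(cardsC [set s | G s]%SET); congr (_ + _)%N.
  by apply: eq_card => s; rewrite !finset.in_set.
have -> : #|[set s | G s]%SET|%:R = (X ^ K)%:R - #|bad|%:R :> R by rewrite -eG natrD addrK.
rewrite lee_fin mulrBl divff ?lt0r_neq0 // lerD2l lerN2.
(* If the edges of weight 0 cover everything, no run is bad; otherwise some edge has positive weight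
   and the level bounds apply. *)
have [U0|/finset.set0Pn[p0 p0U]] := eqVneq (uncovered0 E w) finset.set0.
  rewrite (_ : bad = finset.set0) ?cards0 ?mul0r ?invr_ge0 //.
  apply/setP => s; rewrite !finset.in_set; apply/negbTE/negPn.
  by rewrite -finset.subset0 (fintype.subset_trans (run_sub _ _ _ _ _ _)) // U0.
apply: (card_late_samples p0U).
have r0 : 0 <= r by apply: le_trans r2.
have := truncn_lt_nat (Num.trunc r).+1 r0; rewrite ltnSn => /esym.
have : (Num.trunc r).+1%:R <= 4 * K%:R + 6 :> R by rewrite -natrM -natrD ler_nat; lia.
set ab' := log_ge1 _ * log_ge1 _ in ab.
have -> : r = 4 * (1500 * ab') by rewrite /r /ab' !mulrA.
rewrite -mulrA -/ab' => h1 h2; exact: (rounding_slack ab (lt_le_trans h2 h1)).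
Qed.

End FastTermination.

Lemma cost_le_min_spanner (R : realType) (V : finType) (E H : {set {set V}})
    (w : {set V} -> R) (k : nat) (C : R) : (0 < k)%N -> 0 < C ->
  (forall H', is_spanner k E H' -> cost w H <= C * cost w H') ->
  cost w H <= C * min_spanner_cost k E w.
Proof.
move=> k0 C0 h; rewrite -ler_pdivrMl //; apply: lb_le_inf.
  exists (cost w E); exists E => //=; split=> // u v uv.
  by exists [:: v]; split; rewrite //= uv.
by move=> _ [H' /= sH' <-]; rewrite ler_pdivrMl // h.
Qed.

Theorem theorem31 (R : realType) :
  exists (A : local_algorithm R) (C1 C2 c : R), 1 <= c /\
  forall (V : finType) (E : {set {set V}}) (w : {set V} -> R) (ID : V -> nat),
    simple_graph E -> connected_graph E ->
    (forall e, e \in E -> 0 <= w e) ->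
    injective ID ->
    (forall tape : V -> nat -> bool, exists t : nat,
       let H := output_graph A E w ID tape t in
       [/\ terminated A E w ID tape t,
           is_spanner 2 E H
         & cost w H <=
           C1 * log_ge1 (max_degree E)%:R * min_spanner_cost 2 E w]) /\
    (forall (d : measure_display) (T : measurableType d)
            (P : probability T R) (tape : T -> V -> nat -> bool),
       iid_fair_bits P (fun (i : V * nat) x => tape x i.1 i.2) ->
       let fast := [set x | exists2 t : nat,
         t%:R <= C2 * log_ge1 (#|V|)%:R *
                 log_ge1 ((max_degree E)%:R * weight_ratio E w)
         & terminated A E w ID (tape x) t] in
       measurable fast /\
       ((1 - (#|V|%:R `^ c)^-1)%:E <= P fast)%E).
Proof.
(* The 5 comes from [harmonic_degree]; [4 * 1500] counts four rounds per iteration. *)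
exists (spanner_algorithm R), (64 * 5), (4 * 1500), 1; split=> // V E w ID E_simple _ w_ge0 ID_inj.
split=> [tape|d T P tape fair].
  have [t [ht hs hc]] := algorithm_correct tape E_simple w_ge0 ID_inj.
  exists t; split=> //; apply: cost_le_min_spanner => // [|H' sH'].
    by rewrite mulr_gt0 // (lt_le_trans ltr01) // log_ge1_ge1.
  apply: le_trans (hc _ sH') _; apply: ler_wpM2r.
    apply: sumr_ge0 => e eH; apply: w_ge0.
    by case: sH' => /fintype.subsetP sE _; apply: sE.
  by rewrite -[leRHS]mulrA ler_wpM2l // harmonic_degree.
have := fast_probability E_simple w_ge0 ID_inj fair.
by rewrite powRr1 // ler0n.
Qed.
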